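(* Let $\Sigma$ be a finite alphabet, let $\Sigma_A^+\subseteq\Sigma^{\mathbb N}$ be a topologically mixing (one-sided) shift of finite type, let $\mu_g$ be a $g$-measure on $\Sigma_A^+$ for the $g$-function $g$, and let $\pi:\Sigma_A^+\to Y=\pi(\Sigma_A^+)\subseteq\overline{\Sigma}^{\mathbb N}$ be a fiber-wise sub-positive mixing single site factor map. If $\log g$ is Bowen (respectively Walters, Hölder), then $\pi_*\mu_g$ is a $g$-measure on $Y$, and the logarithm of the $g$-function for $\pi_*\mu_g$ is Bowen (respectively Walters, Hölder).
   Context: Shift of finite type: $A$ is a $0$-$1$ matrix indexed by $\Sigma$, and $\Sigma_A^+=\{(x_i)_{i\ge0}\in\Sigma^{\mathbb N}: A_{x_ix_{i+1}}=1\ \forall i\}$, with the left shift $T$. A word is admissible in a subshift if it occurs in some point of it. Single site factor map: given a map $\pi:\Sigma\to\overline\Sigma$ of finite alphabets, the induced map is $\pi((x_i)_{i\ge0})=(\pi(x_i))_{i\ge0}$; $Y$ is the image of $\Sigma_A^+$; $\pi$ is applied letter by letter to words. $\pi_*\mu(E)=\mu(\pi^{-1}E)$. Fiber-wise sub-positive mixing: there exists $N$ such that for any word $b_0\cdots b_N$ admissible in $Y$ and any words $u_0\cdots u_N$, $w_0\cdots w_N$ admissible in $\Sigma_A^+$ with $\pi(u_0\cdots u_N)=\pi(w_0\cdots w_N)=b_0\cdots b_N$, there is a word $a_0\cdots a_N$ admissible in $\Sigma_A^+$ with $\pi(a_0\cdots a_N)=b_0\cdots b_N$, $a_0=u_0$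 and $a_N=w_N$. Regularity classes: let $X$ be $\Sigma_A^+$ or $Y$ and $\varphi:X\to\mathbb R$. Put $\operatorname{var}_n\varphi=\sup\{|\varphi(x)-\varphi(y)|:x_i=y_i,\ 0\le i\le n-1\}$ and $S_n\varphi(x)=\sum_{i=0}^{n-1}\varphi(T^ix)$. - $\varphi$ is Hölder if there are a constant $|\varphi|_\theta$ and $0<\theta<1$ with $\operatorname{var}_n\varphi\le|\varphi|_\theta\theta^n$ for all $n\ge0$. - $\varphi$ is Walters if $\sup_{n\ge1}\operatorname{var}_{n+k}S_n\varphi\to0$ as $k\to\infty$. - $\varphi$ is Bowen if $\varphi$ is continuous and there is a constant $K$ with $\sup_{n\ge1}\operatorname{var}_nS_n\varphi\le K$. $g$-measures: a $g$-function on $X$ is a continuous $g:X\to(0,1]$ with $\sum_{y\in X,\,Ty=x}g(y)=1$ for all $x\in X$. A Borel probability measure $\mu$ on $X$ is a $g$-measure for $g$ (and $g$ is the $g$-function for $\mu$) if $\int\sum_{Ty=x}g(y)f(y)\,d\mu(x)=\int f\,d\mu$ for all continuous $f:X\to\mathbb R$. *)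

(* Defs.v *)
From HB Require Import structures.
From mathcomp Require Import all_boot all_order all_algebra.
From mathcomp Require Import all_classical all_reals all_analysis.
Import Order.TTheory GRing.Theory Num.Theory.
Import numFieldNormedType.Exports.

Set Implicit Arguments.
Unset Strict Implicit.
Unset Printing Implicit Defensive.

Local Open Scope classical_set_scope.
Local Open Scope ring_scope.

Notation full_shift S := (prod_topology (fun _ : nat => discrete_topology S)).

Definition shift_seq (S : finType) (x : full_shift S) : full_shift S :=
  fun i => x i.+1.

(* Closedness is not recorded: the only instances used below are subshifts of
   finite type and their images under single site factor maps, which are
   closed. Nonemptiness is needed because measurable types are pointed. *)
Record shift_space (S : finType) := ShiftSpace {
  carrier : set (full_shift S);
  carrier_neq0 : carrier !=set0;
  carrier_shift : forall x, carrier x -> carrier (shift_seq x) }.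

Definition space (S : finType) (X : shift_space S) : Type := carrier X.
Coercion space : shift_space >-> Sortclass.

Section Space.
Context {S : finType} (X : shift_space S).

HB.instance Definition _ := Topological.copy (space X) (set_type (carrier X)).
HB.instance Definition _ := isPointed.Build (space X)
  (SigSub (mem_set (svalP (cid (carrier_neq0 X))))).
HB.instance Definition _ :=
  Measurable.copy (space X) (g_sigma_algebraType (@open (space X))).

Definition coords (x : space X) : nat -> S := set_val x.

Definition shift (x : X) : X :=
  SigSub (mem_set (carrier_shift (set_valP x))).

End Space.
Coercion coords : space >-> Funclass.

(* The 0-1 matrix is given as a boolean relation. *)
Definition sft_set (S : finType) (A : rel S) : set (full_shift S) :=
  [set x | forall i, A (x i) (x i.+1)].

Lemma sft_set_shift (S : finType) (A : rel S) x :
  sft_set A x -> sft_set A (shift_seq x).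
Proof. by move=> Ax i; exact: Ax. Qed.

Definition sft (S : finType) (A : rel S) (neA : sft_set A !=set0) :
  shift_space S := ShiftSpace neA (@sft_set_shift S A).

Lemma prod_continuous (T : topologicalType) (I : Type)
    (K : I -> topologicalType) (f : T -> prod_topology K) :
  (forall i, continuous (fun y => f y i)) -> continuous f.
Proof.
move=> cf x; apply/cvg_sup => i A [_ [[B oB <-] Bpx] sBA].
by apply: (filterS sBA); apply: (cf i x); exact: open_nbhs_nbhs.
Qed.

Lemma nbhs_coord (S : finType) (x : full_shift S) i :
  nbhs x [set y : full_shift S | y i = x i].
Proof.
have pc : continuous (@proj nat (fun=> discrete_topology S) i :
    full_shift S -> discrete_topology S).
  exact: (@proj_continuous nat (fun=> discrete_topology S)).
have oU : open (@proj nat (fun=> discrete_topology S) i @^-1` [set x i] :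
    set (full_shift S)).
  by move: pc => /continuousP; apply; exact: discrete_open.
by apply: open_nbhs_nbhs; split => //; exact: oU.
Qed.

Definition letterwise (S S' : finType) (p : S -> S') (x : full_shift S) :
  full_shift S' := fun i => p (x i).

Lemma letterwise_continuous (S S' : finType) (p : S -> S') :
  continuous (@letterwise S S' p).
Proof.
apply: (@prod_continuous _ nat (fun=> discrete_topology S')) => i x A Ai.
have : nbhs x ((fun y : full_shift S => letterwise p y i) @^-1` A).
  apply: (@filterS _ _ _ [set y : full_shift S | y i = x i]).
    by move=> y /= yi; rewrite /letterwise yi; exact: (nbhs_singleton Ai).
  exact: nbhs_coord.
by [].
Qed.

Section Factor.
Context {S S' : finType} (p : S -> S') (X : shift_space S).
Local Notation letterwise := (@letterwise S S' p).

Lemma factor_neq0 : letterwise @` carrier X !=set0.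
Proof. by have [x Xx] := carrier_neq0 X; exists (letterwise x), x. Qed.

Lemma factor_shift y :
  (letterwise @` carrier X) y -> (letterwise @` carrier X) (shift_seq y).
Proof.
by move=> [x Xx <-]; exists (shift_seq x) => //; exact: carrier_shift.
Qed.

Definition factor_space : shift_space S' := ShiftSpace factor_neq0 factor_shift.

Definition factor_map (x : X) : factor_space :=
  SigSub (mem_set (imageP letterwise (set_valP x))).

Lemma factor_map_continuous : continuous factor_map.
Proof.
apply/continuousP => _ [W oW <-]; exists (letterwise @^-1` W); last by [].
by have /continuousP := @letterwise_continuous S S' p; exact.
Qed.

Lemma factor_map_measurable : measurable_fun [set: X] factor_map.
Proof.
apply: (@measurability _ _ _ _ _ _ (@open factor_space)) => //.
move=> _ [B oB <-]; rewrite setTI; apply: sub_sigma_algebra.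
by have /continuousP := factor_map_continuous; exact.
Qed.

HB.instance Definition _ :=
  isMeasurableFun.Build _ _ _ _ factor_map factor_map_measurable.

End Factor.

Definition topologically_mixing (S : finType) (X : shift_space S) : Prop :=
  forall U V : set X, open U -> U !=set0 -> open V -> V !=set0 ->
  exists N, forall n, (N <= n)%N -> U `&` (iter n (@shift S X) @^-1` V) !=set0.

Definition admissible (S : finType) (X : shift_space S) (w : seq S) : Prop :=
  exists (x : X) (k : nat), w = mkseq (fun i => x (k + i)%N) (size w).

Definition fiberwise_subpositive_mixing (S S' : finType) (p : S -> S')
    (X : shift_space S) : Prop :=
  exists N : nat, forall (b : N.+1.-tuple S') (u w : N.+1.-tuple S),
    admissible (factor_space p X) b -> admissible X u -> admissible X w ->
    map_tuple p u = b -> map_tuple p w = b ->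
    exists a : N.+1.-tuple S,
      [/\ admissible X a, map_tuple p a = b,
          tnth a ord0 = tnth u ord0 & tnth a ord_max = tnth w ord_max].

Section Regularity.
Context {R : realType} {S : finType} {X : shift_space S}.
Implicit Type phi : X -> R.

(* The suprema are taken in the extended reals, where they are meaningful for
   unbounded functions. *)
Definition var (n : nat) phi : \bar R :=
  ereal_sup [set `|phi xy.1 - phi xy.2|%:E
            | xy in [set xy : X * X | forall i, (i < n)%N -> xy.1 i = xy.2 i]].

Definition birkhoff_sum (n : nat) phi (x : X) : R :=
  \sum_(0 <= i < n) phi (iter i (@shift S X) x).

Definition Holder phi : Prop :=
  exists C theta : R, 0 < theta < 1 /\
    forall n : nat, (var n phi <= (C * theta ^+ n)%:E)%E.

Definition Walters phi : Prop :=
  (fun k : nat => ereal_sup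
     [set var (n + k)%N (birkhoff_sum n phi) | n in [set n | (1 <= n)%N]])
    @ \oo --> 0%E.

Definition Bowen phi : Prop :=
  continuous phi /\
  exists K : R, (ereal_sup
     [set var n (birkhoff_sum n phi) | n in [set n | (1 <= n)%N]] <= K%:E)%E.

End Regularity.

Section GMeasure.
Context {R : realType} {S : finType} {X : shift_space S}.

(* The finitely supported sums range over the preimages of [x] under the
   shift, of which there are at most #|S|. *)
Definition is_g_function (g : X -> R) : Prop :=
  [/\ continuous g, forall x, 0 < g x <= 1 &
      forall x, \sum_(y \in [set y | shift y = x]) g y = 1].

Definition is_g_measure_for (mu : probability X R) (g : X -> R) : Prop :=
  is_g_function g /\
  forall f : X -> R, continuous f ->
    (\int[mu]_x (\sum_(y \in [set y | shift y = x]) g y * f y)%:E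
     = \int[mu]_x (f x)%:E)%E.

Definition is_g_measure (mu : probability X R) : Prop :=
  exists g : X -> R, is_g_measure_for mu g.

End GMeasure.

(* Main.v *)
(* Write Z b x for the total g-weight of the lifts w of a word b with w x
   admissible.  Sorting preimages by their image word shows that pi_* mu is a
   g-measure for h(y) = lim Z(y_0...y_n)(x) / Z(y_1...y_n)(x), provided the
   limit exists uniformly in x.  These quotients are weighted averages of the
   preceding ones, so their range over x decreases with n.  Fiber-wise mixing
   lets any lift be rerouted to any endpoint at bounded cost; with bounded
   distortion this yields a Harnack inequality Z c x <= C Z c x', and the same
   argument for the quotient minus its lower bound shows that the range
   contracts by a fixed factor, up to the variation of the quotient on long
   cylinders.  Continuity of g makes this error small for a fixed numerator,
   which gives h; bounded distortion of the Z c gives the Bowen property.  The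
   Walters condition makes the error uniform in the length of the numerator,
   which controls var_{n+k} S_n log h.  In the Hoelder case the range plus a
   small multiple of the Hoelder seminorm contracts geometrically.
   Topological mixing forces mu to charge every open set, so that h is the
   only continuous candidate. *)

Require Import Defs.
From HB Require Import structures.
From mathcomp Require Import all_boot all_order all_algebra.
From mathcomp Require Import all_classical all_reals all_analysis.
From mathcomp Require Import measurable_realfun.
From mathcomp Require Import ring lra zify.
Import Order.TTheory GRing.Theory Num.Theory.
Import numFieldNormedType.Exports.

Set Implicit Arguments.
Unset Strict Implicit.
Unset Printing Implicit Defensive.

Local Open Scope classical_set_scope.
Local Open Scope ring_scope.

Local Notation shift := Defs.shift.

(** * One-sided sequences and words *)

Section Words.
Context {S : Type}.
Implicit Types (x y z : nat -> S) (w : seq S).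

(** Rerouting preserves only the first letter of a point, whereas the quotient [Z (c ++ d) / Z d] is
    not controlled by one letter. Two blocks are therefore appended before each contraction: next to
    the point, a block of length [N.+1] in which rerouting takes place; in front of it, a free
    block, whose lifts prefixed to two points with a common first letter make them share so many
    letters that the quotient hardly changes. Denominators vanish at points that no lift of [d] can
    precede, so inequalities are kept in multiplied form. Bounds for a numerator [c] are relative to
    the value of [Z c] at one admissible point; this makes them uniform in the length of [c],
    although [Z c] may decay exponentially. In the g-measure identity, transferring the pullback of
    [f] by [g] and transferring [f] by [h] do not agree pointwise, because the one-letter sum over a
    fibre depends on the lift. Integrals against [mu] are invariant under the transfer operator, so
    the difference may be replaced by its [n]-th iterate; that iterate splits over words [d] into
    terms [Z (b :: d) - h * Z d], which are uniformly small. *)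

Definition scons (a : S) x : nat -> S := fun i => if i is j.+1 then x j else a.
Definition wcat w x := foldr scons x w.
Definition sdrop n x : nat -> S := fun i => x (n + i)%N.
Definition stake n x : seq S := mkseq x n.
Definition agree n x y := forall i, (i < n)%N -> x i = y i.

Lemma scons_hd_tl x : scons (x 0%N) (sdrop 1 x) = x.
Proof. by apply/funext; case. Qed.

Lemma sdrop_scons a x : sdrop 1 (scons a x) = x.
Proof. by apply/funext. Qed.

Lemma sdrop0 x : sdrop 0 x = x.
Proof. by apply/funext. Qed.

Lemma sdropD m n x : sdrop m (sdrop n x) = sdrop (n + m) x.
Proof. by apply/funext => i; rewrite /sdrop addnA. Qed.

Lemma wcat_cat v w x : wcat (v ++ w) x = wcat v (wcat w x).
Proof. exact: foldr_cat. Qed.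

Lemma wcat_ge w x i : wcat w x (size w + i)%N = x i.
Proof. by elim: w => //= a w IH; rewrite addSn. Qed.

Lemma sdrop_wcat w x : sdrop (size w) (wcat w x) = x.
Proof. by apply/funext => i; rewrite /sdrop wcat_ge. Qed.

Lemma stakeS n x : stake n.+1 x = x 0%N :: stake n (sdrop 1 x).
Proof.
rewrite /stake /mkseq /=; congr (_ :: _).
by rewrite (iotaDl 1 0 n) -map_comp.
Qed.

Lemma stakeD m n x : stake (m + n) x = stake m x ++ stake n (sdrop m x).
Proof.
rewrite /stake /mkseq iotaD map_cat add0n; congr (_ ++ _).
by rewrite -[X in iota X _]addn0 iotaDl -map_comp.
Qed.

Lemma size_stake n x : size (stake n x) = n.
Proof. exact: size_mkseq. Qed.

Lemma wcat_stake n x : wcat (stake n x) (sdrop n x) = x.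
Proof.
elim: n x => [|n IH] x; first by rewrite sdrop0.
by rewrite stakeS /= -[sdrop n.+1 x](sdropD n 1 x) IH scons_hd_tl.
Qed.

Lemma stake_wcat w x : stake (size w) (wcat w x) = w.
Proof.
by elim: w => //= a w IH; rewrite stakeS /= sdrop_scons IH.
Qed.

Lemma eq_stake n x y : agree n x y -> stake n x = stake n y.
Proof. by move=> xy; apply/eq_in_map => i; rewrite mem_iota add0n => /xy. Qed.

Lemma stake_agree n x y : stake n x = stake n y -> agree n x y.
Proof.
move=> xy i ni; have := congr1 (fun s => nth (x 0%N) s i) xy.
by rewrite !nth_mkseq.
Qed.

Lemma agree_sym n x y : agree n x y -> agree n y x.
Proof. by move=> xy i ni; rewrite xy. Qed.

Lemma agree_le m n x y : (m <= n)%N -> agree n x y -> agree m x y.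
Proof. by move=> mn xy i mi; apply: xy; apply: leq_trans mn. Qed.

Lemma agree_trans n x y z : agree n x y -> agree n y z -> agree n x z.
Proof. by move=> xy yz i ni; rewrite xy // yz. Qed.

Lemma agree_wcat w n x y :
  agree n x y -> agree (size w + n) (wcat w x) (wcat w y).
Proof.
move=> xy; elim: w => // a w IH [|i] //=.
by rewrite addSn ltnS => /IH.
Qed.

Lemma agree_sdrop m n x y :
  agree (m + n) x y -> agree n (sdrop m x) (sdrop m y).
Proof. by move=> xy i ni; apply: xy; rewrite ltn_add2l. Qed.

End Words.

Lemma stake_comp (S S' : Type) (p : S -> S') n (x : nat -> S) :
  stake n (p \o x) = map p (stake n x).
Proof. by rewrite /stake /mkseq -map_comp. Qed.

Lemma sdrop_comp (S S' : Type) (p : S -> S') n (x : nat -> S) :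
  sdrop n (p \o x) = p \o sdrop n x.
Proof. by []. Qed.

Lemma scons_comp (S S' : Type) (p : S -> S') a (x : nat -> S) :
  p \o scons a x = scons (p a) (p \o x).
Proof. by apply/funext; case. Qed.

Lemma wcat_comp (S S' : Type) (p : S -> S') w (x : nat -> S) :
  p \o wcat w x = wcat (map p w) (p \o x).
Proof. by elim: w => //= a w <-; rewrite scons_comp. Qed.

Section Lifts.
Context {S S' : finType} (p : S -> S').

Fixpoint lifts (d : seq S') : seq (seq S) :=
  if d is b :: d' then
    [seq a :: w | a <- enum [pred a | p a == b], w <- lifts d']
  else [:: [::]].

Lemma mem_lifts d w : (w \in lifts d) = (map p w == d).
Proof.
elim: d w => [|b d IH] w /=; first by rewrite inE; case: w.
apply/allpairsP/eqP => [[[a v] [/= + + ->]]|].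
  by rewrite mem_enum inE IH => /eqP <- /eqP <-.
case: w => // a v [pa pv]; exists (a, v); split => //=.
  by rewrite mem_enum inE pa.
by rewrite IH pv.
Qed.

Lemma size_lifts d w : w \in lifts d -> size w = size d.
Proof. by rewrite mem_lifts => /eqP <-; rewrite size_map. Qed.

Lemma lifts_cat d e : lifts (d ++ e) = [seq v ++ w | v <- lifts d, w <- lifts e].
Proof.
elim: d => /= [|b d ->]; first by rewrite cats0 map_id.
elim: (enum _) => // a s IHs.
rewrite allpairs_cons IHs [in RHS]allpairs_cons allpairs_cat; congr (_ ++ _).
by rewrite map_allpairs allpairs_mapl.
Qed.

End Lifts.

(** * Weights of lifted words *)

(* [gfun] is extended by 0 outside the subshift [gdom], so that sums over
   preimages need not mention admissibility. *)
Record gsystem (R : realType) (S : finType) := GSystem {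
  gdom : set (nat -> S);
  gfun : (nat -> S) -> R;
  gmin : R;
  gdom_scons : forall a x y, gdom x -> gdom y -> x 0%N = y 0%N ->
    gdom (scons a x) -> gdom (scons a y);
  gdom_sdrop1 : forall x, gdom x -> gdom (sdrop 1 x);
  gfun_out : forall x, ~ gdom x -> gfun x = 0;
  gmin_gt0 : 0 < gmin;
  gmin_le1 : gmin <= 1;
  gfun_ge : forall x, gdom x -> gmin <= gfun x;
  gfun_sum : forall x, gdom x -> \sum_(a : S) gfun (scons a x) = 1 }.

Section Operator.
Context {R : realType} {S S' : finType} (p : S -> S') (G : gsystem R S).
Local Notation X := (gdom G).
Local Notation gg := (gfun G).
Local Notation gm := (gmin G).
Implicit Types (x y z : nat -> S) (F : (nat -> S) -> R) (v w : seq S).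
Implicit Types c d e : seq S'.

Fixpoint weight w x : R := if w is a :: w' then gg (wcat w x) * weight w' x else 1.
Definition gprod n x : R := \prod_(0 <= i < n) gg (sdrop i x).
(** The iterated transfer operator of [g], restricted to the inverse branches that lie over [d]. *)
Definition fiber_op d F x : R := \sum_(w <- lifts p d) weight w x * F (wcat w x).
Definition fiber_sum d x : R := fiber_op d (fun=> 1) x.

Local Notation lop := fiber_op.
Local Notation Z := fiber_sum.

Lemma gdom_sdrop n x : X x -> X (sdrop n x).
Proof.
elim: n => [|n IH] Xx; first by rewrite sdrop0.
by rewrite -addn1 -sdropD; apply: gdom_sdrop1; exact: IH.
Qed.

Lemma gdom_wcat w x y : X x -> X y -> x 0%N = y 0%N -> X (wcat w x) ->
  X (wcat w y).
Proof.
move=> Xx Xy xy; elim: w => // a w IH /= Xa.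
have Xw : X (wcat w x) by move/gdom_sdrop1 : Xa; rewrite sdrop_scons.
apply: gdom_scons Xa => //; first exact: IH.
by case: (w).
Qed.

Lemma gfun_ge0 x : 0 <= gg x.
Proof.
have [Xx|Xx] := pselect (X x); last by rewrite gfun_out.
exact: le_trans (ltW (gmin_gt0 G)) (gfun_ge Xx).
Qed.

Lemma weight_ge0 w x : 0 <= weight w x.
Proof. by elim: w => //= a w IH; rewrite mulr_ge0 // gfun_ge0. Qed.

Lemma weight_out w x : X x -> ~ X (wcat w x) -> weight w x = 0.
Proof. by case: w => //= a w Xx Xw; rewrite gfun_out ?mul0r. Qed.

Lemma weight_cat v w x : weight (v ++ w) x = weight v (wcat w x) * weight w x.
Proof.
by elim: v => /= [|a v ->]; rewrite ?mul1r // -mulrA wcat_cat.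
Qed.

Lemma weight_gprod w x : weight w x = gprod (size w) (wcat w x).
Proof.
rewrite /gprod; elim: w => [|a w IH]; first by rewrite big_geq.
by rewrite /= big_nat_recl //= sdrop0 IH.
Qed.

Lemma gprod_ge n x : X x -> gm ^+ n <= gprod n x.
Proof.
move=> Xx; rewrite /gprod; elim: n => [|n IH]; first by rewrite big_geq.
rewrite big_nat_recr //= exprSr ler_pM ?exprn_ge0 ?(ltW (gmin_gt0 G)) //.
exact/(@gfun_ge _ _ G)/gdom_sdrop.
Qed.

Lemma weight_ge w x : X (wcat w x) -> gm ^+ size w <= weight w x.
Proof. by rewrite weight_gprod; exact: gprod_ge. Qed.

Lemma fiber_op_nil F x : lop [::] F x = F x.
Proof. by rewrite /fiber_op big_seq1 mul1r. Qed.

(** Here [e] is prepended before [d], and [weight] is a cocycle, so the operators compose in the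
    opposite order. *)
Lemma fiber_op_cat d e F x : lop (d ++ e) F x = lop e (lop d F) x.
Proof.
rewrite /fiber_op lifts_cat big_allpairs_dep exchange_big /=; apply: eq_bigr => w _.
rewrite big_distrr /=; apply: eq_bigr => v _.
by rewrite weight_cat wcat_cat mulrCA mulrA.
Qed.

Lemma fiber_op_le d F F' x : X x ->
  (forall w, w \in lifts p d -> X (wcat w x) -> F (wcat w x) <= F' (wcat w x)) ->
  lop d F x <= lop d F' x.
Proof.
move=> Xx FF'; rewrite /fiber_op big_seq [leRHS]big_seq; apply: ler_sum => w wd.
have [Xw|Xw] := pselect (X (wcat w x)); last by rewrite weight_out ?mul0r.
by rewrite ler_wpM2l ?weight_ge0 // FF'.
Qed.

Lemma fiber_op_lin d F F' k l x :
  lop d (fun z => k * F z + l * F' z) x = k * lop d F x + l * lop d F' x.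
Proof.
rewrite /fiber_op !mulr_sumr -big_split; apply: eq_bigr => w _ /=.
by rewrite mulrDr !(mulrCA (weight w x)).
Qed.

Lemma fiber_op_scale d F k x : lop d (fun z => k * F z) x = k * lop d F x.
Proof.
by rewrite /fiber_op !mulr_sumr; apply: eq_bigr => w _; rewrite mulrCA.
Qed.

Lemma fiber_op_cst d k x : lop d (fun=> k) x = k * Z d x.
Proof.
by rewrite -fiber_op_scale /fiber_op; apply: eq_bigr => w _; rewrite mulr1.
Qed.

Lemma fiber_op_ge0 d F x : X x -> (forall z, X z -> 0 <= F z) -> 0 <= lop d F x.
Proof.
move=> Xx F0; rewrite -(mul0r (Z d x)) -fiber_op_cst; apply: fiber_op_le => // w _.
exact: F0.
Qed.

Lemma fiber_sum_ge0 d x : X x -> 0 <= Z d x.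
Proof. by move=> Xx; apply: fiber_op_ge0. Qed.

Lemma fiber_op1 b F x :
  lop [:: b] F x = \sum_(a | p a == b) gg (scons a x) * F (scons a x).
Proof.
rewrite /fiber_op (_ : lifts p [:: b] = [seq [:: a] | a <- enum [pred a | p a == b]]).
  by rewrite big_map big_enum; apply: eq_bigr => a _; rewrite /= mulr1.
by rewrite /lifts allpairs1r.
Qed.

Lemma fiber_op1_sum F x :
  \sum_(b : S') lop [:: b] F x = \sum_a gg (scons a x) * F (scons a x).
Proof.
rewrite [RHS](partition_big p xpredT) //; apply: eq_bigr => b _.
by rewrite fiber_op1.
Qed.

(** Summing over the new letter applies the full transfer operator to the constant 1, which it
    fixes. *)
Lemma fiber_sum_sum d x : X x -> \sum_(b : S') Z (b :: d) x = Z d x.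
Proof.
move=> Xx; rewrite /fiber_sum -(eq_bigr _ (fun b _ => esym (fiber_op_cat [:: b] d _ x))).
rewrite exchange_big /=; apply: eq_bigr => w _.
rewrite -big_distrr /=.
have [Xw|Xw] := pselect (X (wcat w x)); last by rewrite weight_out ?mul0r.
rewrite fiber_op1_sum; under eq_bigr do rewrite mulr1.
by rewrite gfun_sum.
Qed.

Lemma fiber_sum_le1 d x : X x -> Z d x <= 1.
Proof.
move=> Xx; elim: d => [|b d IH]; first by rewrite /fiber_sum fiber_op_nil.
rewrite (le_trans _ IH) // -(fiber_sum_sum d Xx) (bigD1 b) //= lerDl.
by rewrite sumr_ge0 // => ? _; exact: fiber_sum_ge0.
Qed.

Lemma fiber_op_ge_term d F w x : X x -> (forall z, X z -> 0 <= F z) ->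
  w \in lifts p d -> X (wcat w x) -> gm ^+ size d * F (wcat w x) <= lop d F x.
Proof.
move=> Xx F0 wd Xw; rewrite /fiber_op (big_rem w) //= -(size_lifts wd).
rewrite (le_trans (ler_wpM2r (F0 _ Xw) (weight_ge Xw))) // lerDl.
rewrite sumr_ge0 // => v _.
have [Xv|Xv] := pselect (X (wcat v x)); last by rewrite weight_out ?mul0r.
by rewrite mulr_ge0 ?weight_ge0 ?F0.
Qed.

Lemma fiber_sum_gt0P d x : X x ->
  0 < Z d x <-> exists2 w, w \in lifts p d & X (wcat w x).
Proof.
move=> Xx; split => [Z0|[w wd Xw]]; last first.
  apply: lt_le_trans (@fiber_op_ge_term d (fun=> 1) w x Xx _ wd Xw) => //.
  by rewrite mulr1 exprn_gt0 ?gmin_gt0.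
apply: contrapT => nw; move: Z0; rewrite /fiber_sum /fiber_op big_seq big1 ?ltxx // => w wd.
by rewrite weight_out ?mul0r // => Xw; apply: nw; exists w.
Qed.

Lemma fiber_sum_eq0 d F x : X x -> ~ 0 < Z d x -> lop d F x = 0.
Proof.
move=> Xx Z0; rewrite /fiber_op big_seq big1 // => w wd.
rewrite weight_out ?mul0r // => Xw.
by apply: Z0; apply/(fiber_sum_gt0P _ Xx); exists w.
Qed.

Lemma fiber_sum_ge_pow d x : X x -> 0 < Z d x -> gm ^+ size d <= Z d x.
Proof.
move=> Xx /(fiber_sum_gt0P _ Xx)[w wd Xw].
have := @fiber_op_ge_term d (fun=> 1) w x Xx (fun _ _ => ler01) wd Xw.
by rewrite mulr1.
Qed.

Lemma fiber_sum_cat_le d e x : X x -> Z (d ++ e) x <= Z e x.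
Proof.
move=> Xx; rewrite /fiber_sum fiber_op_cat; apply: fiber_op_le => // w _ Xw.
exact: fiber_sum_le1.
Qed.

Lemma fiber_sum_stake_gt0 n z : X z -> 0 < Z (stake n (p \o z)) (sdrop n z).
Proof.
move=> Xz; apply/fiber_sum_gt0P; first exact: gdom_sdrop.
exists (stake n z); last by rewrite wcat_stake.
by rewrite mem_lifts stake_comp.
Qed.

(** Term by term comparison is possible because points with the same first letter admit the same
    prefixes. *)
Lemma fiber_op_dist d tau F F' z z' : X z -> X z' -> z 0%N = z' 0%N -> 0 <= tau ->
  (forall w, w \in lifts p d -> X (wcat w z) ->
     [/\ weight w z <= tau * weight w z', 0 <= F (wcat w z) &
         F (wcat w z) <= F' (wcat w z')]) ->
  lop d F z <= tau * lop d F' z'.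
Proof.
move=> Xz Xz' zz' tau0 H; rewrite /fiber_op mulr_sumr big_seq [leRHS]big_seq.
apply: ler_sum => w wd; rewrite mulrA.
have [Xw|Xw] := pselect (X (wcat w z)).
  by have [? ? ?] := H _ wd Xw; rewrite ler_pM // weight_ge0.
rewrite weight_out // mul0r weight_out ?mulr0 ?mul0r // => Xw'; apply: Xw.
exact: gdom_wcat Xw'.
Qed.

(** Here [j] counts the letters shared beyond the [n] steps: the Bowen condition is a fixed [tau] at
    [j = 0], the Walters condition makes [tau] close to 1 for large [j], uniformly in [n]. *)
Definition distortion n j tau := forall x x', X x -> X x' -> agree (n + j) x x' ->
  gprod n x <= tau * gprod n x'.

Lemma distortion_wt n j tau w z z' : distortion n j tau -> size w = n -> agree j z z' ->
  X (wcat w z) -> X (wcat w z') -> weight w z <= tau * weight w z'.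
Proof.
move=> dn wn zz' Xw Xw'; rewrite !weight_gprod wn; apply: dn => //.
by rewrite -wn; exact: agree_wcat.
Qed.

Lemma fiber_sum_dist d j tau z z' : distortion (size d) j.+1 tau -> 0 <= tau ->
  X z -> X z' -> agree j.+1 z z' -> Z d z <= tau * Z d z'.
Proof.
move=> dd tau0 Xz Xz' zz'; have z0 : z 0%N = z' 0%N by exact: zz'.
apply: fiber_op_dist => // w wd Xw; split => //.
by apply: (distortion_wt dd) => //; [exact: size_lifts wd|exact: gdom_wcat Xw].
Qed.

End Operator.

(** * Contraction of the quotients *)

Section Mixing.
Context {R : realType} {S S' : finType} (p : S -> S') (G : gsystem R S).
Local Notation X := (gdom G).
Local Notation gm := (gmin G).
Local Notation lop := (fiber_op p G).
Local Notation Z := (fiber_sum p G).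
Context (N : nat) (CK : R).
Context (mix : forall x x', X x -> X x' -> agree N.+1 (p \o x) (p \o x') ->
  exists z, [/\ X z, z 0%N = x 0%N, agree N.+1 (p \o z) (p \o x') &
                sdrop N.+1 z = sdrop N.+1 x']).
Context (CK_ge1 : 1 <= CK) (bowen : forall n, distortion G n 0 CK).
Implicit Types (x y z : nat -> S) (w : seq S) (c d e : seq S').

Let gm_gt0 : 0 < gm. Proof. exact: gmin_gt0. Qed.
Let CK_gt0 : 0 < CK. Proof. exact: lt_le_trans CK_ge1. Qed.

Lemma bowen1 n j : distortion G n j CK.
Proof.
by move=> x x' Xx Xx' xx'; apply: bowen => //; apply: agree_le xx'; lia.
Qed.

(** The point given by [mix] has the tail [x'], so its first [N.+1] letters form the required
    lift. *)
Lemma mix_lift e x x' w w' : size e = N.+1 -> w \in lifts p e ->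
  w' \in lifts p e -> X (wcat w x) -> X (wcat w' x') ->
  exists v, [/\ v \in lifts p e, X (wcat v x') &
                wcat v x' 0%N = wcat w x 0%N].
Proof.
move=> se we w'e Xw Xw'.
have sw : size w = N.+1 by rewrite (size_lifts we).
have sw' : size w' = N.+1 by rewrite (size_lifts w'e).
have st u t : u \in lifts p e -> stake N.+1 (p \o wcat u t) = e.
  move=> ue; rewrite stake_comp -se -(size_lifts ue) stake_wcat.
  by move: ue; rewrite mem_lifts => /eqP.
have [|z [Xz z0 pz dz]] := mix Xw Xw'.
  by apply: stake_agree; rewrite !st.
have zE : z = wcat (stake N.+1 z) x'.
  have <- : sdrop N.+1 z = x' by rewrite dz -sw' sdrop_wcat.
  by rewrite wcat_stake.
exists (stake N.+1 z); rewrite -zE; split => //.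
by rewrite mem_lifts -stake_comp (eq_stake pz) st.
Qed.

(* Every lift over [e] is rerouted, at a bounded cost, so that it ends at
   [x'] while keeping its first letter. *)
Lemma harnack e F1 F2 rho x x' : size e = N.+1 -> 0 <= rho ->
  (forall z z', X z -> X z' -> z 0%N = z' 0%N -> F1 z <= rho * F2 z') ->
  (forall z, X z -> 0 <= F2 z) -> X x -> X x' -> 0 < Z e x' ->
  lop e F1 x <= rho / gm ^+ N.+1 * lop e F2 x'.
Proof.
move=> se rho0 F12 F20 Xx Xx' /(fiber_sum_gt0P _ _ Xx')[w' w'e Xw'].
set B := _ * lop e F2 x'.
have B0 : 0 <= B.
  apply: mulr_ge0; last exact: fiber_op_ge0.
  by rewrite divr_ge0 ?exprn_ge0 // ltW.
(* Every term will be bounded by [B], and the weights over [e] add up to at most 1. *)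
apply: (@le_trans _ _ (lop e (fun=> B) x)); last first.
  by rewrite fiber_op_cst ler_piMr // fiber_sum_le1.
apply: fiber_op_le => // w we Xw.
have [v [ve Xv v0]] := mix_lift se we w'e Xw Xw'.
apply: le_trans (F12 _ _ Xw Xv (esym v0)) _.
rewrite /B -mulrA ler_wpM2l // ler_pdivlMl ?exprn_gt0 // -se.
exact: fiber_op_ge_term.
Qed.

Definition harnackC := CK / gm ^+ N.+1.

Let gmN_gt0 : 0 < gm ^+ N.+1. Proof. by rewrite exprn_gt0. Qed.

Lemma harnackC_gt0 : 0 < harnackC. Proof. by rewrite divr_gt0. Qed.

Lemma fiber_sum_bowen d z z' : X z -> X z' -> z 0%N = z' 0%N -> Z d z <= CK * Z d z'.
Proof.
move=> Xz Xz' zz'; apply: (@fiber_sum_dist _ _ _ _ _ _ 0) => //.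
- exact: bowen1.
- exact: ltW.
- by case.
Qed.

(** The last [N.+1] letters of [c] absorb the rerouting and the rest costs only distortion. Shorter
    words are covered by the trivial bounds 1 and [gm ^+ size c]. *)
Lemma fiber_sum_harnack c x x' : X x -> X x' -> 0 < Z c x' -> Z c x <= harnackC * Z c x'.
Proof.
move=> Xx Xx' Zx'; have [cN|cN] := leqP (size c) N.
  apply: (le_trans (fiber_sum_le1 _ _ Xx)).
  have := fiber_sum_ge_pow Xx' Zx'.
  have : gm ^+ N.+1 <= gm ^+ size c.
    by rewrite ler_wiXn2l ?gmin_le1 ?ltW //; lia.
  move=> h1 h2; rewrite /harnackC mulrAC ler_pdivlMr // mul1r.
  rewrite (le_trans (le_trans h1 h2)) // ler_peMl // fiber_sum_ge0 //.
have [c1 [c2 [cE sc2]]] : exists c1 c2, c = c1 ++ c2 /\ size c2 = N.+1.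
  exists (take (size c - N.+1) c), (drop (size c - N.+1) c).
  by rewrite cat_take_drop size_drop; split=> //; lia.
rewrite {1}/fiber_sum cE /harnackC /fiber_sum !fiber_op_cat; apply: harnack => //.
- exact: ltW.
- by move=> z z' *; exact: fiber_sum_bowen.
- by move=> z Xz; exact: fiber_sum_ge0.
- apply: lt_le_trans Zx' _; rewrite cE; exact: fiber_sum_cat_le.
Qed.

(* The quotient [Z (c ++ d) / Z d] lies in [m, M]; it is left undivided because
   [Z d x] vanishes when no lift of [d] can precede [x]. *)
Definition brackets c d m M := forall x, X x ->
  m * Z d x <= Z (c ++ d) x <= M * Z d x.

Lemma brackets_cat c d e m M : brackets c d m M -> brackets c (d ++ e) m M.
Proof.
move=> H x Xx; rewrite catA /fiber_sum !(fiber_op_cat _ _ _ e) -!fiber_op_scale.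
by apply/andP; split; apply: fiber_op_le => // w _ Xw; have /andP[] := H _ Xw.
Qed.

(** The inverse of [harnackC]. *)
Definition baseC := gm ^+ N.+1 / CK.

Lemma baseC_gt0 : 0 < baseC. Proof. by rewrite divr_gt0. Qed.

(** For the lower bound, one lift of the [N.+1] letters is rerouted so as to start with the letter
    of [z]; there [Z c] is comparable to [Z c z]. Without this block, [Z c] could vanish at other
    points. *)
Lemma brackets_base c z : X z -> 0 < Z c z ->
  brackets c (stake N.+1 (p \o z)) (baseC * Z c z) (harnackC * Z c z).
Proof.
move=> Xz Zz; set d := stake _ _; have sd : size d = N.+1 by exact: size_stake.
move=> x Xx; rewrite [Z (c ++ d) x]fiber_op_cat; apply/andP; split; last first.
  by rewrite -fiber_op_cst; apply: fiber_op_le => // w _ Xw; exact: fiber_sum_harnack.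
have [Zx|Zx] := pselect (0 < Z d x); last first.
  by rewrite [Z d x](fiber_sum_eq0 _ Xx Zx) (fiber_sum_eq0 _ Xx Zx) mulr0.
have [w wd Xw] := (fiber_sum_gt0P _ _ Xx).1 Zx.
have zd : stake N.+1 z \in lifts p d by rewrite mem_lifts /d stake_comp.
have Xz' : X (wcat (stake N.+1 z) (sdrop N.+1 z)) by rewrite wcat_stake.
have [v [vd Xv v0]] := mix_lift sd zd wd Xz' Xw.
rewrite wcat_stake in v0.
have cz := fiber_sum_bowen c Xz Xv (esym v0).
apply: (@le_trans _ _ (baseC * Z c z)).
  by rewrite ler_piMr ?fiber_sum_le1 // mulr_ge0 ?fiber_sum_ge0 // ltW // baseC_gt0.
apply: le_trans (fiber_op_ge_term Xx _ vd Xv); last by move=> *; exact: fiber_sum_ge0.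
by rewrite /baseC -mulrA sd ler_pM2l // ler_pdivrMl.
Qed.

(** One [CK] pays for the weights over the free block, one for [Z d], the power of [gm] for
    rerouting, and [harnackC] for changing the denominator from one point to the other. *)
Definition contrC := gm ^+ N.+1 / (CK ^+ 2 * harnackC).

Lemma contrC_gt0 : 0 < contrC.
Proof. by rewrite divr_gt0 // mulr_gt0 ?exprn_gt0 ?harnackC_gt0. Qed.

Lemma contrC_le1 : contrC <= 1.
Proof.
have gN1 : gm ^+ N.+1 <= 1 by rewrite exprn_ile1 ?gmin_le1 // ltW.
have H1 : 1 <= harnackC by rewrite ler_pdivlMr // mul1r (le_trans gN1).
have C1 : 1 <= CK ^+ 2 by rewrite exprn_ege1.
have D0 : 0 < CK ^+ 2 * harnackC by rewrite mulr_gt0 ?exprn_gt0 ?harnackC_gt0.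
rewrite ler_pdivrMr // mul1r (le_trans gN1) //.
by rewrite (le_trans C1) // ler_peMr // ltW // exprn_gt0.
Qed.

(* [Z (c ++ d) / Z d] varies by at most [v] over points sharing [j] letters,
   again without dividing. *)
Definition ratio_osc c d j v := forall z z', X z -> X z' -> agree j z z' ->
  Z (c ++ d) z * Z d z' <= (Z (c ++ d) z' + v * Z d z') * Z d z.

(** With [q = Z (c ++ d) / Z d], this multiplies [q z - m <= q z' - (m - v)] by
    [Z d z <= tau * Z d z']. If [Z d z' = 0], the brackets force every term to vanish. *)
Lemma ratio_osc_shift c d m M j v z z' : brackets c d m M -> 0 <= v ->
  ratio_osc c d j.+1 v -> X z -> X z' -> agree j.+1 z z' ->
  forall tau, Z d z <= tau * Z d z' ->
  Z (c ++ d) z - m * Z d z <= tau * (Z (c ++ d) z' - (m - v) * Z d z').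
Proof.
move=> H v0 ov Xz Xz' zz' tau tz.
have /andP[h1 h2] := H z Xz; have /andP[h3 h4] := H z' Xz'.
have Z0 := fiber_sum_ge0 p d Xz; have Z0' := fiber_sum_ge0 p d Xz'.
have ozz' := ov _ _ Xz Xz' zz'.
have [Zz'|Zz'] := ltP 0 (Z d z'); last first.
  have E : Z d z' = 0 by apply/eqP; rewrite eq_le Zz'.
  have E' : Z d z = 0 by apply/eqP; rewrite eq_le Z0 andbT -(mulr0 tau) -E.
  move: h1 h2 h3 h4; rewrite E E' !mulr0 !subr0 => h1 h2 h3 h4.
  have -> : Z (c ++ d) z = 0 by apply/eqP; rewrite eq_le h1 h2.
  by have -> : Z (c ++ d) z' = 0; [apply/eqP; rewrite eq_le h3 h4|rewrite mulr0].
rewrite -(ler_pM2r Zz').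
have A0 : 0 <= Z (c ++ d) z' - (m - v) * Z d z'.
  by move: h3 (mulr_ge0 v0 Z0'); lra.
apply: (@le_trans _ _ ((Z (c ++ d) z' - (m - v) * Z d z') * Z d z)).
  by move: ozz'; lra.
rewrite [leRHS](_ : _ = (Z (c ++ d) z' - (m - v) * Z d z') * (tau * Z d z')).
  by rewrite ler_wpM2l.
by ring.
Qed.

(** The Harnack inequality for the excess of the quotient over [m]. After a lift of [e1] is
    prefixed, points with the same first letter share [(size e1).+1] letters, so their quotients
    differ by at most [v]; lowering [m] by [v] absorbs this. The block [e2] carries the
    rerouting. *)
Lemma brackets_compare c d e1 e2 m M v x x' : brackets c d m M -> 0 <= v ->
  size e2 = N.+1 -> ratio_osc c d (size e1).+1 v ->
  X x -> X x' -> 0 < Z (d ++ e1 ++ e2) x -> 0 < Z (d ++ e1 ++ e2) x' ->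
  (Z (c ++ d ++ e1 ++ e2) x - m * Z (d ++ e1 ++ e2) x) / Z (d ++ e1 ++ e2) x
  <= contrC^-1 *
  ((Z (c ++ d ++ e1 ++ e2) x' - (m - v) * Z (d ++ e1 ++ e2) x')
     / Z (d ++ e1 ++ e2) x').
Proof.
move=> H v0 se2 ov Xx Xx' Zx Zx'.
pose F1 := lop e1 (fun z => 1 * Z (c ++ d) z + (- m) * Z d z).
pose F2 := lop e1 (fun z => 1 * Z (c ++ d) z + (- (m - v)) * Z d z).
have E k y : lop e2 (lop e1 (fun z => 1 * Z (c ++ d) z + (- k) * Z d z)) y =
    Z (c ++ d ++ e1 ++ e2) y - k * Z (d ++ e1 ++ e2) y.
  by rewrite -fiber_op_cat fiber_op_lin -!fiber_op_cat -catA mul1r mulNr.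
have CK2 : 0 <= CK ^+ 2 by rewrite exprn_ge0 // ltW.
have F20 z : X z -> 0 <= F2 z.
  move=> Xz; apply: fiber_op_ge0 => // y Xy.
  have /andP[h _] := H _ Xy; have := mulr_ge0 v0 (fiber_sum_ge0 p d Xy).
  by move: h; lra.
have F12 z z' : X z -> X z' -> z 0%N = z' 0%N -> F1 z <= CK ^+ 2 * F2 z'.
  move=> Xz Xz' zz'; rewrite expr2 -mulrA -[CK * F2 z']fiber_op_scale.
  have a1 : agree 1 z z' by case.
  apply: fiber_op_dist => //; first exact: ltW.
  move=> w we Xw; have Xw' := gdom_wcat Xz Xz' zz' Xw.
  have sw := size_lifts we.
  have aw : agree (size e1).+1 (wcat w z) (wcat w z').
    by have := @agree_wcat _ w _ _ _ a1; rewrite sw addn1.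
  split.
  - exact: (distortion_wt (@bowen1 (size e1) 1%N)).
  - by have /andP[h _] := H _ Xw; move: h; lra.
  - rewrite !mul1r !mulNr; apply: (ratio_osc_shift H v0 ov) => //.
    by apply: fiber_sum_bowen => //; exact: aw.
have Ze2 : 0 < Z e2 x'.
  by apply: lt_le_trans Zx' _; rewrite catA; exact: fiber_sum_cat_le.
have := harnack se2 CK2 F12 F20 Xx Xx' Ze2; rewrite !E => h.
have hZ := fiber_sum_harnack Xx' Xx Zx.
set A := _ - _ in h *; set B := _ - (m - v) * _ in h *.
rewrite ler_pdivrMr // (le_trans h) //.
have B0 : 0 <= B by rewrite /B -E fiber_op_ge0.
rewrite [leRHS](_ : _ = (CK ^+ 2 / gm ^+ N.+1 * B) *
  (harnackC * Z (d ++ e1 ++ e2) x / Z (d ++ e1 ++ e2) x')); last first.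
  by rewrite /contrC invf_div; ring.
rewrite ler_peMr //; last by rewrite ler_pdivlMr // mul1r.
by rewrite mulr_ge0 // divr_ge0 // ltW.
Qed.

(** A dichotomy at the midpoint [h]: either the quotient never exceeds [h], which becomes the upper
    bound, or it does so at some [x], and comparing every other point with [x] raises the lower
    bound. *)
Lemma brackets_step c d e1 e2 m M v : brackets c d m M -> m <= M -> 0 <= v ->
  size e2 = N.+1 -> ratio_osc c d (size e1).+1 v ->
  exists m' M', [/\ brackets c (d ++ e1 ++ e2) m' M', m <= m', m' <= M', M' <= M &
    M' - m' <= (1 - contrC / 2) * (M - m) + v].
Proof.
move=> H mM v0 se2 ov; set f := d ++ e1 ++ e2.
have Hf : brackets c f m M by exact: brackets_cat.
have k0 := contrC_gt0; have k1 := contrC_le1.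
have Mm0 : 0 <= M - m by rewrite subr_ge0.
have zero x : X x -> ~ 0 < Z f x -> Z f x = 0 /\ Z (c ++ f) x = 0.
  move=> Xx Zx; have E : Z f x = 0 by apply: fiber_sum_eq0.
  by have := Hf x Xx; rewrite E !mulr0 => /le_anti ->.
pose h := (M + m) / 2.
have [Hx|] := pselect (forall x, X x -> Z (c ++ f) x <= h * Z f x).
  exists m, h; split => //; rewrite ?/h; try lra.
    by move=> x Xx; rewrite Hx // andbT; have /andP[] := Hf x Xx.
  have : contrC * (M - m) <= 1 * (M - m) by rewrite ler_wpM2r.
  by lra.
move=> /existsNP[x /not_implyP[Xx /negP]]; rewrite -ltNge => hx.
have Zx : 0 < Z f x.
  by apply: contrapT => /(zero _ Xx)[E E']; move: hx; rewrite E E' mulr0 ltxx.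
(* The maximum keeps the lower bounds monotone when [v] outweighs the gain. *)
pose m' := Num.max m (m + contrC / 2 * (M - m) - v).
exists m', M; split => //.
- move=> x' Xx'; have /andP[h1 ->] := Hf x' Xx'; rewrite andbT.
  have [Zx'|/(zero _ Xx')[-> ->]] := pselect (0 < Z f x'); last by rewrite mulr0.
  have := brackets_compare H v0 se2 ov Xx Xx' Zx Zx'; rewrite -/f.
  rewrite -(ler_pM2l k0) mulVKf ?lt0r_neq0 //.
  rewrite ler_pdivlMr // => hc.
  rewrite /m'; have [_|_] := leP m (m + contrC / 2 * (M - m) - v); last exact: h1.
  apply: (@le_trans _ _ ((m - v) * Z f x' + contrC * (h - m) * Z f x')).
    by rewrite /h -mulrDl; apply: ler_wpM2r; [exact: ltW|lra].
  rewrite -lerBrDl; apply: le_trans hc; rewrite ler_wpM2r ?(ltW Zx') //.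
  rewrite ler_wpM2l ?(ltW k0) // ler_pdivlMr // mulrBl lerD2r.
  exact: ltW.
- by rewrite /m' le_max lexx.
- rewrite /m' ge_max mM /=.
  have : contrC / 2 * (M - m) <= 1 * (M - m) by rewrite ler_wpM2r //; lra.
  lra.
- have : m + contrC / 2 * (M - m) - v <= m' by rewrite /m' le_max lexx orbT.
  lra.
Qed.

(** * Decay of the oscillation of the quotients *)

Lemma distortion_le n j j' tau : (j <= j')%N -> distortion G n j tau ->
  distortion G n j' tau.
Proof.
by move=> jj' H x x' Xx Xx' xx'; apply: H => //; apply: agree_le xx'; lia.
Qed.

(** Numerator and denominator each change by a factor [tau] at most, and the quotient itself is at
    most [M]. *)
Lemma ratio_osc_dist c d j m M tau : distortion G (size (c ++ d)) j.+1 tau ->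
  distortion G (size d) j.+1 tau -> 1 <= tau -> 0 <= M -> brackets c d m M ->
  ratio_osc c d j.+1 ((tau ^+ 2 - 1) * M).
Proof.
move=> dcd dd tau1 M0 H z z' Xz Xz' zz'.
have tau0 : 0 <= tau by exact: le_trans tau1.
have h1 := fiber_sum_dist p dcd tau0 Xz Xz' zz'.
have h2 := fiber_sum_dist p dd tau0 Xz' Xz (agree_sym zz').
have /andP[_ h3] := H z' Xz'.
have Z0 := fiber_sum_ge0 p d Xz; have Z0' := fiber_sum_ge0 p d Xz'.
have Zc0 := fiber_sum_ge0 p (c ++ d) Xz; have Zc0' := fiber_sum_ge0 p (c ++ d) Xz'.
apply: (@le_trans _ _ (tau * Z (c ++ d) z' * (tau * Z d z))).
  by rewrite ler_pM.
rewrite (_ : _ * _ * _ = (Z (c ++ d) z' + (tau ^+ 2 - 1) * Z (c ++ d) z') *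
   Z d z); last by ring.
rewrite ler_wpM2r // lerD2l -mulrA ler_wpM2l // subr_ge0.
by rewrite exprn_ege1.
Qed.

(** [I] is the set of permitted numerator lengths: length 1 gives [hlim], all lengths give its
    products along orbits. The level [k] must serve all numerators at once. *)
Definition osc_bound (I : set nat) (k : nat) (r : R) :=
  forall c z, I (size c) -> X z -> 0 < Z c z ->
  exists m M, [/\ brackets c (stake k (p \o z)) m M, baseC * Z c z <= m, m <= M,
                  M <= harnackC * Z c z & M - m <= r * Z c z].

Definition modulus (I : set nat) := forall k r, 0 < r ->
  exists j, forall n, I n -> distortion G (n + k) j (1 + r) /\ distortion G k j (1 + r).

Lemma osc_bound_base I : osc_bound I N.+1 harnackC.
Proof.
move=> c z _ Xz Zz; exists (baseC * Z c z), (harnackC * Z c z).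
have h0 : 0 <= baseC * Z c z by rewrite mulr_ge0 ?fiber_sum_ge0 // ltW // baseC_gt0.
split => //; [exact: brackets_base| |by rewrite lerBlDr lerDl].
have /andP[] := brackets_base Xz Zz (gdom_sdrop N.+1 Xz).
have := fiber_sum_stake_gt0 p N.+1 Xz; set u := Z (stake _ _) _ => u0 h1 h2.
by have := le_trans h1 h2; rewrite ler_pM2r.
Qed.

Lemma osc_boundW I k k' r r' : (k <= k')%N -> r <= r' -> osc_bound I k r ->
  osc_bound I k' r'.
Proof.
move=> kk' rr' H c z Ic Xz Zz; have [m [M [h1 h2 h3 h4 h5]]] := H c z Ic Xz Zz.
exists m, M; split => //; first by rewrite -(subnKC kk') stakeD; exact: brackets_cat.
by apply: le_trans h5 _; rewrite ler_wpM2r // ltW.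
Qed.

Lemma osc_bound_step I k r r' : modulus I -> 0 < r' ->
  osc_bound I k r -> exists k', osc_bound I k' ((1 - contrC / 2) * r + r').
Proof.
move=> modI r'0 Hk; have HC0 := harnackC_gt0.
(* As [q <= 1], one has [(1 + q) ^+ 2 - 1 <= 3 * q]; together with [M <= harnackC * Z c z] this
   keeps the error below [r' * Z c z]. *)
pose q := Num.min 1 (r' / (3 * harnackC)).
have q0 : 0 < q by rewrite /q lt_min ltr01 divr_gt0 // mulr_gt0.
have [j Hj] := modI k _ q0; exists (k + (j + N.+1))%N => c z Ic Xz Zz.
have [m [M [h1 h2 h3 h4 h5]]] := Hk c z Ic Xz Zz.
have m0 : 0 < m by apply: lt_le_trans h2; rewrite mulr_gt0 ?baseC_gt0.
set d := stake k _ in h1.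
pose e1 := stake j (sdrop k (p \o z)).
pose e2 := stake N.+1 (sdrop j (sdrop k (p \o z))).
have E : stake (k + (j + N.+1)) (p \o z) = d ++ e1 ++ e2 by rewrite !stakeD.
have [d1 d2] := Hj _ Ic.
have M0 : 0 <= M by rewrite (le_trans _ h3) // ltW.
have oM : ratio_osc c d (size e1).+1 (((1 + q) ^+ 2 - 1) * M).
  rewrite size_stake; apply: ratio_osc_dist h1 => //; last by rewrite lerDl ltW.
  - by rewrite size_cat size_stake; exact: distortion_le d1.
  - by rewrite size_stake; exact: distortion_le d2.
have q1 : q <= 1 by rewrite /q ge_min lexx.
have qr : q * (3 * harnackC) <= r'.
  have H3 : 0 < 3 * harnackC by rewrite mulr_gt0.
  by rewrite -(ler_pdivlMr _ _ H3) /q ge_min lexx orbT.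
have oM0 : 0 <= ((1 + q) ^+ 2 - 1) * M.
  by rewrite mulr_ge0 // subr_ge0 exprn_ege1 // lerDl ltW.
have se2 : size e2 = N.+1 by exact: size_stake.
have [m' [M' [g1 g2 g3 g4 g5]]] := brackets_step h1 h3 oM0 se2 oM.
exists m', M'; rewrite E; split => //.
- exact: le_trans g2.
- exact: le_trans h4.
- apply: (le_trans g5).
  rewrite [leRHS]mulrDl lerD //.
    by rewrite -[leRHS]mulrA ler_wpM2l //; move: contrC_le1; lra.
  apply: (@le_trans _ _ (3 * q * (harnackC * Z c z))).
    rewrite ler_pM //; first by rewrite subr_ge0 exprn_ege1 // lerDl ltW.
    by move: (ltW q0) => q0'; nra.
  rewrite (_ : 3 * q * (harnackC * Z c z) = q * (3 * harnackC) * Z c z); last by ring.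
  by rewrite ler_wpM2r // ltW.
Qed.

Lemma expr_small (q r : R) : 0 <= q < 1 -> 0 < r -> exists i, q ^+ i <= r.
Proof.
move=> /andP[q0 q1] r0; have /cvg_expr : `|q| < 1 by rewrite ger0_norm.
move=> /cvgrPdist_le/(_ _ r0)[i _ /(_ i (leqnn i))] /=.
by rewrite sub0r normrN ger0_norm ?exprn_ge0 //; exists i.
Qed.

Lemma osc_bound_small I r : modulus I -> 0 < r -> exists k, osc_bound I k r.
Proof.
move=> modI r0; have HC0 := harnackC_gt0; have k0 := contrC_gt0; have k1 := contrC_le1.
(* Half of the gain [contrC / 2] is given up to the error term. *)
have iter i : exists k, osc_bound I k ((1 - contrC / 4) ^+ i * harnackC).
  elim: i => [|i [k IH]].
    by exists N.+1; rewrite expr0 mul1r; exact: osc_bound_base.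
  have s0 : 0 < (1 - contrC / 4) ^+ i * harnackC.
    by rewrite mulr_gt0 // exprn_gt0 //; lra.
  have [|k' Hk'] := osc_bound_step (r' := contrC / 4 * ((1 - contrC / 4) ^+ i * harnackC))
    modI _ IH; first by rewrite mulr_gt0 //; lra.
  exists k'; move: Hk'; rewrite -mulrDl exprS -mulrA.
  by congr (osc_bound _ _ (_ * _)); lra.
have [||i hi] := @expr_small (1 - contrC / 4) (r / harnackC); [lra|by rewrite divr_gt0|].
have [k Hk] := iter i; exists k; apply: osc_boundW Hk => //.
by rewrite -ler_pdivlMr.
Qed.

(* [hlim (y_0 y_1 ...)] is the limit of
   [Z (y_0 ... y_k) / Z (y_1 ... y_k)], packaged as a supremum of the eventual
   lower bounds. *)
Definition hlim (y : nat -> S') : R :=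
  sup [set m | exists k, forall x, X x ->
         m * Z (stake k (sdrop 1 y)) x <= Z (stake k.+1 y) x].

(** A lower bound found at a level [k'] and the upper bound [M] both persist to level [k + k']. They
    are compared there at the tail of [z], where the denominator is positive. *)
Lemma hlim_bnd z k m M : X z ->
  brackets [:: p (z 0%N)] (stake k (p \o sdrop 1 z)) m M -> m <= hlim (p \o z) <= M.
Proof.
rewrite /hlim => Xz H; set A := (X in sup X).
have Am : A m by exists k => x /H /andP[]; rewrite stakeS.
have AM : ubound A M.
  move=> m' [k' Hk']; have Zz := fiber_sum_stake_gt0 p (k + k') (gdom_sdrop 1 Xz).
  have Xn := gdom_sdrop (k + k') (gdom_sdrop 1 Xz).
  rewrite -(ler_pM2r Zz).
  apply: (@le_trans _ _ (Z ([:: p (z 0%N)] ++ stake (k + k') (p \o sdrop 1 z))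
     (sdrop (k + k') (sdrop 1 z)))).
    rewrite addnC stakeD /fiber_sum catA !(fiber_op_cat _ _ _ (stake k _)) -fiber_op_scale.
    apply: fiber_op_le; first by rewrite addnC.
    by move=> w _ Xw; have := Hk' _ Xw; rewrite stakeS.
  by rewrite stakeD; have /andP[] := brackets_cat (stake k' (sdrop k (p \o sdrop 1 z))) H Xn.
apply/andP; split.
  by apply: ub_le_sup => //; exists M.
by apply: ge_sup => //; exists m.
Qed.

Lemma fiber_sum_hd_ge z : X z -> gm <= Z [:: p (z 0%N)] (sdrop 1 z).
Proof.
move=> Xz; have := fiber_sum_ge_pow (gdom_sdrop 1 Xz) (fiber_sum_stake_gt0 p 1 Xz).
by rewrite expr1.
Qed.

Lemma hlim_ge z : X z -> baseC * gm <= hlim (p \o z).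
Proof.
move=> Xz; have H := brackets_base (gdom_sdrop 1 Xz) (fiber_sum_stake_gt0 p 1 Xz).
have /andP[h _] := hlim_bnd Xz H.
apply: le_trans h; rewrite ler_wpM2l ?(ltW baseC_gt0) //; exact: fiber_sum_hd_ge.
Qed.

Lemma hlim_le1 z : X z -> hlim (p \o z) <= 1.
Proof.
move=> Xz; suff H : brackets [:: p (z 0%N)] (stake 0 (p \o sdrop 1 z)) 0 1.
  by have /andP[] := hlim_bnd Xz H.
by move=> x Xx; rewrite mul0r mul1r fiber_sum_ge0 // fiber_sum_cat_le.
Qed.

(** * Products of the limit along an orbit *)

Definition ratio n k z : R :=
  Z (stake (n + k) (p \o z)) (sdrop (n + k) z) /
  Z (stake k (p \o sdrop n z)) (sdrop (n + k) z).

Lemma ratio_bnd n k k' z m M : X z ->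
  brackets (stake n (p \o z)) (stake k (p \o sdrop n z)) m M -> (k <= k')%N ->
  m <= ratio n k' z <= M.
Proof.
move=> Xz H kk'; have Zk' := fiber_sum_stake_gt0 p k' (gdom_sdrop n Xz).
rewrite sdropD in Zk'.
rewrite /ratio ler_pdivlMr // ler_pdivrMr //.
have -> : stake (n + k') (p \o z) =
    stake n (p \o z) ++ stake k' (p \o sdrop n z) by exact: stakeD.
rewrite -[in stake k' _](subnKC kk') stakeD.
exact: (brackets_cat _ H (gdom_sdrop (n + k') Xz)).
Qed.

Lemma ratio1_cvg z : modulus [set 1%N] -> X z ->
  ratio 1 k z @[k --> \oo] --> hlim (p \o z).
Proof.
move=> mod1 Xz; apply/cvgrPdist_le => r r0.
have [k Hk] := osc_bound_small mod1 r0.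
have Xz1 := gdom_sdrop 1 Xz.
have [m [M [h1 h2 h3 h4 h5]]] := Hk [:: p (z 0%N)] _ erefl Xz1 (fiber_sum_stake_gt0 p 1 Xz).
exists k => // k' /= kk'.
have /andP[g1 g2] := hlim_bnd Xz h1.
have /andP[g3 g4] := @ratio_bnd 1 k k' z m M Xz h1 kk'.
have : M - m <= r.
  by apply: (le_trans h5); rewrite ler_piMr ?fiber_sum_le1 // ltW.
by rewrite ler_norml; lra.
Qed.

(** Telescoping identifies the limit of the [n]-letter quotients with a product of [n] values of
    [hlim]. *)
Lemma ratio_prod n k z : X z ->
  ratio n.+1 k z = ratio n k.+1 z * ratio 1 k (sdrop n z).
Proof.
move=> Xz; rewrite /ratio !sdropD add1n addn1 addnS addSn.
have := fiber_sum_stake_gt0 p k.+1 (gdom_sdrop n Xz); rewrite sdropD addnS => /lt0r_neq0 h.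
by rewrite mulrA mulfVK.
Qed.

Definition hprod n (y : nat -> S') : R := \prod_(0 <= i < n) hlim (sdrop i y).

Lemma ratio_cvg n z : modulus [set 1%N] -> X z ->
  ratio n k z @[k --> \oo] --> hprod n (p \o z).
Proof.
move=> mod1 Xz; elim: n => [|n IH].
  rewrite /hprod big_geq // (_ : ratio 0 ^~ z = fun=> 1); first exact: cvg_cst.
  apply/funext => k; rewrite /ratio add0n sdrop0 divff // lt0r_neq0 //.
  exact: fiber_sum_stake_gt0.
rewrite /hprod big_nat_recr //= -/(hprod n _).
rewrite (_ : ratio n.+1 ^~ z = fun k => ratio n k.+1 z * ratio 1 k (sdrop n z)).
  apply: cvgM; first by rewrite (cvg_shiftS (ratio n ^~ z)).
  exact: ratio1_cvg (gdom_sdrop n Xz).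
by apply/funext => k; rewrite ratio_prod.
Qed.

(** The product is bounded through the [n]-letter numerator as a whole, so no error accumulates over
    its factors. *)
Lemma hprod_bnd n k z m M : modulus [set 1%N] -> X z ->
  brackets (stake n (p \o z)) (stake k (p \o sdrop n z)) m M ->
  m <= hprod n (p \o z) <= M.
Proof.
move=> mod1 Xz H; have Hc := @ratio_cvg n z mod1 Xz; apply/andP; split.
  by apply: (ler_cvg_to (cvg_cst m) Hc); exists k => // k' /= /(ratio_bnd Xz H) /andP[].
by apply: (ler_cvg_to Hc (cvg_cst M)); exists k => // k' /= /(ratio_bnd Xz H) /andP[].
Qed.

(** One [harnackC] is the upper base bracket, the other compares [Z] at the two tails, and [baseC]
    is the lower base bracket. *)
Lemma hprod_bowen n z z' : modulus [set 1%N] -> X z -> X z' ->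
  agree n (p \o z) (p \o z') ->
  hprod n (p \o z) <= harnackC ^+ 2 / baseC * hprod n (p \o z').
Proof.
move=> mod1 Xz Xz' zz'; have Xn := gdom_sdrop n Xz; have Xn' := gdom_sdrop n Xz'.
have Zn := fiber_sum_stake_gt0 p n Xz; have Zn' := fiber_sum_stake_gt0 p n Xz'.
have /andP[_ h1] := hprod_bnd mod1 Xz (brackets_base Xn Zn).
have /andP[h2 _] := hprod_bnd mod1 Xz' (brackets_base Xn' Zn').
apply: (le_trans h1).
rewrite (eq_stake zz') in Zn *.
have h3 := fiber_sum_harnack Xn Xn' Zn'.
have k0 := baseC_gt0; have H0 := harnackC_gt0.
apply: (@le_trans _ _ (harnackC ^+ 2 * Z (stake n (p \o z')) (sdrop n z'))).
  by rewrite expr2 -mulrA ler_pM2l.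
by rewrite -mulrA ler_pM2l ?exprn_gt0 // ler_pdivlMl.
Qed.

(** Both products lie in the same bracket, whose relative width is at most [r / baseC] because [m]
    is at least [baseC * Z c z]. *)
Lemma hprod_osc I n k r z z' : modulus [set 1%N] -> I n -> osc_bound I k r ->
  0 <= r -> X z -> X z' -> agree (n + k) (p \o z) (p \o z') ->
  hprod n (p \o z) <= (1 + r / baseC) * hprod n (p \o z').
Proof.
move=> mod1 In Hk r0 Xz Xz' zz'; have Xn := gdom_sdrop n Xz.
have Zn := fiber_sum_stake_gt0 p n Xz.
have [|m [M [h1 h2 h3 h4 h5]]] := Hk _ _ _ Xn Zn; first by rewrite size_stake.
have k0 := baseC_gt0.
have /andP[g1 g2] := hprod_bnd mod1 Xz h1.
have /andP[g3 _] : m <= hprod n (p \o z') <= M.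
  have E1 := eq_stake (agree_le (leq_addr k n) zz').
  have E2 : stake k (p \o sdrop n z) = stake k (p \o sdrop n z').
    exact: (eq_stake (agree_sdrop zz')).
  by apply: (@hprod_bnd n k z') => //; rewrite -E1 -E2.
apply: (le_trans g2); rewrite mulrDl mul1r.
have : M - m <= r / baseC * m.
  apply: (le_trans h5); rewrite -mulrA ler_wpM2l // ler_pdivlMl //.
have : r / baseC * m <= r / baseC * hprod n (p \o z').
  by rewrite ler_wpM2l // divr_ge0 // ltW.
lra.
Qed.

Lemma ratio_osc_vle c d j v v' : v <= v' -> ratio_osc c d j v -> ratio_osc c d j v'.
Proof.
move=> vv' H z z' Xz Xz' zz'; apply: le_trans (H z z' Xz Xz' zz') _.
by rewrite ler_wpM2r ?fiber_sum_ge0 // lerD2l ler_wpM2r // fiber_sum_ge0.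
Qed.

(** The three factors [tau] come from the weights over [e], from [Z d] and from [Z (d ++ e)]. The
    old oscillation enters at the finer scale [size e + j.+1]. *)
Lemma ratio_osc_next c d e m M j tau v : brackets c d m M -> 0 <= v -> 1 <= tau ->
  ratio_osc c d (size e + j.+1) v -> distortion G (size e) j.+1 tau ->
  distortion G (size d) (size e + j.+1) tau -> distortion G (size (d ++ e)) j.+1 tau ->
  ratio_osc c (d ++ e) j.+1 ((tau ^+ 3 - 1) * (M - m) + tau ^+ 3 * v).
Proof.
move=> H v0 tau1 ov de dd dde x x' Xx Xx' xx'.
have tau0 : 0 <= tau by exact: le_trans tau1.
have x0 : x 0%N = x' 0%N by exact: xx'.
have E k y : lop e (fun z => 1 * Z (c ++ d) z + (- k) * Z d z) y =
    Z (c ++ d ++ e) y - k * Z (d ++ e) y.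
  by rewrite fiber_op_lin -!fiber_op_cat -catA mul1r mulNr.
set f := d ++ e in E *.
have a0 := fiber_sum_ge0 p f Xx; have a0' := fiber_sum_ge0 p f Xx'.
have h1 : Z (c ++ f) x - m * Z f x <=
    tau ^+ 2 * (Z (c ++ f) x' - (m - v) * Z f x').
  rewrite -!E expr2 -mulrA -[tau * lop e _ x']fiber_op_scale.
  apply: fiber_op_dist => // w we Xw; have Xw' := gdom_wcat Xx Xx' x0 Xw.
  have sw := size_lifts we.
  have aw : agree (size e + j.+1) (wcat w x) (wcat w x').
    by have := @agree_wcat _ w _ _ _ xx'; rewrite sw.
  split.
  - exact: (distortion_wt de).
  - by have /andP[h _] := H _ Xw; move: h; lra.
  - rewrite !mul1r !mulNr; rewrite addnS in ov aw dd.
    apply: (ratio_osc_shift H v0 ov) => //; exact: (fiber_sum_dist p dd).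
have h2 := fiber_sum_dist p dde tau0 Xx' Xx (agree_sym xx').
have /andP[h3 h4] := brackets_cat e H Xx'; rewrite -/f in h2 h3 h4.
set A := Z (c ++ f) x in h1 *; set a := Z f x in h1 h2 a0 *.
set A' := Z (c ++ f) x' in h1 h3 h4 *; set a' := Z f x' in h1 h2 h3 h4 a0' *.
have B0 : 0 <= tau ^+ 2 * (A' - (m - v) * a').
  by rewrite mulr_ge0 ?exprn_ge0 //; move: h3 (mulr_ge0 v0 a0'); lra.
have g1 : (A - m * a) * a' <= tau ^+ 2 * (A' - (m - v) * a') * (tau * a).
  by apply: (le_trans (ler_wpM2r a0' h1)); rewrite ler_wpM2l.
have t3 : 0 <= tau ^+ 3 - 1 by rewrite subr_ge0 exprn_ege1.
have g2 : (tau ^+ 3 - 1) * (A' - m * a') * a <= (tau ^+ 3 - 1) * ((M - m) * a') * a.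
  by rewrite ler_wpM2r // ler_wpM2l //; lra.
have E1 : (A - m * a) * a' = A * a' - m * a * a' by ring.
have E2 : tau ^+ 2 * (A' - (m - v) * a') * (tau * a) =
  (tau ^+ 3 - 1) * (A' - m * a') * a + A' * a - m * a * a' + tau ^+ 3 * v * a' * a.
  by ring.
have E3 : (A' + ((tau ^+ 3 - 1) * (M - m) + tau ^+ 3 * v) * a') * a =
   A' * a + (tau ^+ 3 - 1) * ((M - m) * a') * a + tau ^+ 3 * v * a' * a by ring.
by rewrite E3; move: g1 g2; rewrite E1 E2; lra.
Qed.

(** * Geometric decay under Hölder distortion *)

Section HolderRate.
Context (theta D : R) (theta01 : 0 < theta < 1) (D0 : 0 <= D).
Context (hold : forall n j, distortion G n j (1 + D * theta ^+ j)).

Let theta0 : 0 <= theta. Proof. by case/andP : theta01 => /ltW. Qed.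
Let theta1 : theta <= 1. Proof. by case/andP : theta01 => _ /ltW. Qed.

Definition ratio_holder c d V := forall j, ratio_osc c d j.+1 (V * theta ^+ j.+1).

Let thetaX_le (i j : nat) : (i <= j)%N -> theta ^+ j <= theta ^+ i.
Proof. by move=> ij; rewrite ler_wiXn2l. Qed.

Let thetaX1 j : theta ^+ j <= 1.
Proof. by rewrite exprn_ile1. Qed.

Let tau_ge1 j : 1 <= 1 + D * theta ^+ j.
Proof. by rewrite lerDl mulr_ge0 // exprn_ge0. Qed.

Let tau_pow k j : (1 + D * theta ^+ j) ^+ k - 1 <= ((1 + D) ^+ k - 1) * theta ^+ j.
Proof.
set t := theta ^+ j; have t0 : 0 <= t by rewrite exprn_ge0.
have t1 : t <= 1 by exact: thetaX1.
elim: k => [|k IH]; first by rewrite !expr0 !subrr mul0r.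
rewrite !exprS; set a := (1 + D * t) ^+ k in IH *; set b := (1 + D) ^+ k in IH *.
have ab : a <= b.
  by rewrite lerXn2r // ?nnegrE ?addr_ge0 ?mulr_ge0 // lerD2l ler_piMr.
have : D * t * a <= D * t * b by rewrite ler_wpM2l // mulr_ge0.
lra.
Qed.

Lemma ratio_holder_base c z : X z -> 0 < Z c z ->
  ratio_holder c (stake N.+1 (p \o z)) (((1 + D) ^+ 2 - 1) * (harnackC * Z c z)).
Proof.
move=> Xz Zz j; set d := stake _ _.
have M0 : 0 <= harnackC * Z c z by rewrite mulr_ge0 ?fiber_sum_ge0 // ltW // harnackC_gt0.
have H := ratio_osc_dist (@hold (size (c ++ d)) j.+1) (@hold (size d) j.+1) (tau_ge1 _) M0
  (brackets_base Xz Zz).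
apply: ratio_osc_vle H; rewrite [leRHS]mulrAC; apply: ler_wpM2r => //; exact: tau_pow.
Qed.

(** An inequality of Lasota-Yorke type: the old seminorm gains [theta ^+ size e], at the price of a
    multiple of the oscillation. *)
Lemma ratio_holder_next c d e m M V : brackets c d m M -> m <= M ->
  0 <= V -> ratio_holder c d V ->
  ratio_holder c (d ++ e)
    (((1 + D) ^+ 3 - 1) * (M - m) + (1 + D) ^+ 3 * theta ^+ size e * V).
Proof.
move=> H mM V0 hV j.
have tX := exprn_ge0 _ theta0.
have v0 : 0 <= V * theta ^+ (size e + j.+1) by rewrite mulr_ge0.
have ov : ratio_osc c d (size e + j.+1) (V * theta ^+ (size e + j.+1)).
  by rewrite addnS; exact: hV.
have dl : distortion G (size d) (size e + j.+1) (1 + D * theta ^+ j.+1).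
  by apply: (@distortion_le _ j.+1); [exact: leq_addl|exact: hold].
have := ratio_osc_next H v0 (tau_ge1 j.+1) ov (@hold _ _) dl (@hold _ _).
apply: ratio_osc_vle; set t := theta ^+ j.+1; rewrite [leRHS]mulrDl; apply: lerD.
  rewrite [leRHS]mulrAC; apply: ler_wpM2r; [by rewrite subr_ge0|exact: tau_pow].
rewrite exprD -/t (_ : _ * _ * _ * t = (1 + D) ^+ 3 * (V * (theta ^+ size e * t)));
  last by ring.
apply: ler_wpM2r; first by rewrite !mulr_ge0 ?tX.
apply: lerXn2r; rewrite ?nnegrE ?addr_ge0 ?mulr_ge0 ?tX //.
by rewrite lerD2l ler_piMr // thetaX1.
Qed.

(* The oscillation alone does not contract geometrically; the combination
   [(M - m) + eta * V] with the Hölder seminorm [V] does. *)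
Lemma osc_bound_geometric : exists r rho K, [/\ (0 < r)%N, 0 < rho < 1, 0 <= K &
  forall I i, osc_bound I (N.+1 + i * r) (K * rho ^+ i)].
Proof.
have k0 := contrC_gt0; have k1 := contrC_le1; have H0 := harnackC_gt0.
set E := (1 + D) ^+ 3; have E1 : 1 <= E by rewrite exprn_ege1 // lerDl.
set E2 := (1 + D) ^+ 2; have E21 : 1 <= E2 by rewrite exprn_ege1 // lerDl.
(* With this weight the oscillation fed into the seminorm costs at most [contrC / 4], half of the
   gain of [brackets_step]. *)
pose eta := contrC / (4 * E).
have E0 : 0 < E by exact: lt_le_trans E1.
have eta0 : 0 < eta by rewrite divr_gt0 // mulr_gt0.
have etaE : eta * E = contrC / 4 by rewrite /eta; field; rewrite lt0r_neq0.
have W0 : 0 < 1 + eta * E by rewrite addr_gt0 // mulr_gt0.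
pose rho := 1 - contrC / 4.
have rho0 : 0 < rho by rewrite /rho; lra.
(* [V] returns as the error [v] of [brackets_step] and as the old seminorm times [eta * E]; [l]
   makes both together at most [rho * eta * V]. *)
have [||l hl] := @expr_small theta (rho * eta / (1 + eta * E)).
- by case/andP : theta01 => _ ->; rewrite theta0.
- by apply: divr_gt0 => //; rewrite mulr_gt0.
pose r := (l + N.+1)%N.
pose K := harnackC + eta * ((E2 - 1) * harnackC).
exists r, rho, K; split; first by rewrite /r addnS.
- by rewrite rho0 /rho; lra.
- apply: addr_ge0; first exact: ltW.
  apply: mulr_ge0; first exact: ltW.
  by apply: mulr_ge0; [rewrite subr_ge0|exact: ltW].
move=> I i c z _ Xz Zz; set t := Z c z in Zz *.
suff [m [M [V [h1 h2 h3 h4 [V0 hV h5]]]]] : exists m M V,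
    [/\ brackets c (stake (N.+1 + i * r) (p \o z)) m M, baseC * t <= m, m <= M,
        M <= harnackC * t &
      [/\ 0 <= V, ratio_holder c (stake (N.+1 + i * r) (p \o z)) V &
          (M - m) + eta * V <= rho ^+ i * (K * t)]].
  exists m, M; split => //; apply: le_trans (le_trans _ h5) _.
    by rewrite lerDl mulr_ge0 // ltW.
  by rewrite mulrA [rho ^+ i * K]mulrC.
elim: i => [|i [m [M [V [h1 h2 h3 h4 [V0 hV h5]]]]]].
  have [m [M [h1 h2 h3 h4 h5]]] := @osc_bound_base setT c z Logic.I Xz Zz.
  exists m, M, ((E2 - 1) * (harnackC * t)); rewrite mul0n addn0; split => //; split.
  - apply: mulr_ge0; first by rewrite subr_ge0.
    by apply: mulr_ge0; exact: ltW.
  - exact: ratio_holder_base.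
  - rewrite expr0 mul1r /K [leRHS]mulrDl lerD //.
    by rewrite -!mulrA.
set d := stake (N.+1 + i * r) _ in h1 hV.
pose e1 := stake l (sdrop (N.+1 + i * r) (p \o z)).
pose e2 := stake N.+1 (sdrop l (sdrop (N.+1 + i * r) (p \o z))).
have se2 : size e2 = N.+1 by exact: size_stake.
have se1 : size e1 = l by exact: size_stake.
have -> : stake (N.+1 + i.+1 * r) (p \o z) = d ++ e1 ++ e2.
  by rewrite mulSn addnCA addnC stakeD [stake r _]stakeD.
have v0 : 0 <= V * theta ^+ l.+1 by rewrite mulr_ge0 // exprn_ge0.
have ov : ratio_osc c d (size e1).+1 (V * theta ^+ l.+1) by rewrite se1; exact: hV.
have [m' [M' [g1 g2 g3 g4 g5]]] := brackets_step h1 h3 v0 se2 ov.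
have hV' := ratio_holder_next (e1 ++ e2) h1 h3 V0 hV.
rewrite size_cat se1 se2 -/r in hV'.
eexists m', M', _; split => //; [exact: le_trans g2|exact: le_trans h4|].
have Mm : 0 <= M - m by rewrite subr_ge0.
split; [|exact: hV'|].
  apply: addr_ge0; apply: mulr_ge0 => //; first by rewrite subr_ge0.
  by apply: mulr_ge0; [exact: ltW|exact: exprn_ge0].
have -> : rho ^+ i.+1 * (K * t) = rho * (rho ^+ i * (K * t)).
  by rewrite exprS mulrA.
apply: le_trans (ler_wpM2l (ltW rho0) h5).
have hl' : theta ^+ l * (1 + eta * E) <= rho * eta.
  by rewrite -ler_pdivlMr.
have u1 : theta ^+ l.+1 * V <= theta ^+ l * V by rewrite ler_wpM2r // thetaX_le.
have u2 : eta * E * (theta ^+ r * V) <= eta * E * (theta ^+ l * V).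
  apply: ler_wpM2l; first by apply: mulr_ge0; exact: ltW.
  by apply: ler_wpM2r => //; apply: thetaX_le; exact: leq_addr.
have u3 : theta ^+ l * (1 + eta * E) * V <= rho * eta * V by rewrite ler_wpM2r.
have u4 : 0 <= eta * (M - m) by rewrite mulr_ge0 // ltW.
have u5 : eta * (E - 1) * (M - m) <= contrC / 4 * (M - m).
  by rewrite ler_wpM2r // mulrBr mulr1 etaE; lra.
have F1 : eta * ((E - 1) * (M - m) + E * theta ^+ r * V) =
   eta * (E - 1) * (M - m) + eta * E * (theta ^+ r * V) by ring.
have F2 : theta ^+ l * (1 + eta * E) * V = theta ^+ l * V + eta * E * (theta ^+ l * V).
  by ring.
rewrite F1; rewrite F2 in u3.
move: g5 u1 u2 u3 u5; rewrite /rho; lra.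
Qed.

Lemma osc_bound_exp : exists K theta', [/\ 0 <= K, 0 < theta' < 1 &
  forall I k, osc_bound I (N.+1 + k) (K * theta' ^+ k)].
Proof.
have [r [rho [K [r0 /andP[rho0 rho1] K0 H]]]] := osc_bound_geometric.
(* By Bernoulli's inequality [rho <= t ^+ r]; the factor [t ^+ r] in the constant pays for the
   remainder of [k] modulo [r]. *)
pose t := 1 - (1 - rho) / r%:R.
have rR : 1 <= r%:R :> R by rewrite ler1n.
have rR0 : 0 < r%:R :> R by exact: lt_le_trans rR.
have q0 : 0 < (1 - rho) / r%:R by rewrite divr_gt0 // subr_gt0.
have q1 : (1 - rho) / r%:R <= 1 - rho.
  by rewrite ler_pdivrMr // ler_peMr // subr_ge0 ltW.
have t0 : 0 < t by rewrite /t; lra.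
have t1 : t < 1 by rewrite /t; lra.
have bern n : 1 - n%:R * ((1 - rho) / r%:R) <= t ^+ n.
  elim: n => [|n IH]; first by rewrite mul0r subr0 expr0.
  have : t * (1 - n%:R * ((1 - rho) / r%:R)) <= t ^+ n.+1.
    by rewrite exprS ler_wpM2l // ltW.
  have : 0 <= n%:R * ((1 - rho) / r%:R) ^+ 2 by rewrite mulr_ge0 ?sqr_ge0.
  by rewrite -natr1 /t; lra.
have rt : rho <= t ^+ r.
  by apply: le_trans (bern r); rewrite mulrCA divff ?lt0r_neq0 //; lra.
exists (K / t ^+ r), t; split; first by rewrite divr_ge0 // exprn_ge0 // ltW.
  by rewrite t0.
move=> I k; apply: osc_boundW (H I (k %/ r)%N).
  by rewrite leq_add2l leq_divM.
rewrite -mulrA ler_wpM2l // ler_pdivlMl ?exprn_gt0 //.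
apply: (@le_trans _ _ (t ^+ r * (t ^+ r) ^+ (k %/ r))).
  by rewrite ler_wpM2l ?exprn_ge0 ?(ltW t0) // lerXn2r // nnegrE ltW // exprn_gt0.
rewrite -exprM -exprD; apply: ler_wiXn2l; rewrite ?(ltW t0) ?(ltW t1) //.
by rewrite {1}(divn_eq k r) mulnC addnC leq_add2r ltnW // ltn_mod.
Qed.

End HolderRate.

(** * The limit as a g-function on the factor *)

Definition factor_dom := [set y : nat -> S' | exists2 x, X x & p \o x = y].

Definition hlim0 (y : nat -> S') : R := if pselect (factor_dom y) then hlim y else 0.

Lemma hlim0_in (y : nat -> S') : factor_dom y -> hlim0 y = hlim y.
Proof. by rewrite /hlim0; case: pselect. Qed.

Lemma hlim0_out (y : nat -> S') : ~ factor_dom y -> hlim0 y = 0.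
Proof. by rewrite /hlim0; case: pselect. Qed.

(** A lift of [y] that some letter over [b] precedes is rerouted into a lift of [y'] with the same
    first letter, so that letter still precedes it. *)
Lemma factor_dom_scons b (y y' : nat -> S') : factor_dom y' ->
  agree N.+1 y y' -> factor_dom (scons b y) ->
  factor_dom (scons b y').
Proof.
move=> [x' Xx' <-] yy' [x0 Xx0 x0E].
have x0y : p \o sdrop 1 x0 = y by rewrite -(sdrop_scons b y) -x0E.
have [|z [Xz z0 pz dz]] := mix (gdom_sdrop 1 Xx0) Xx'; first by rewrite x0y.
exists (scons (x0 0%N) z).
  apply: (gdom_scons (gdom_sdrop 1 Xx0) Xz (esym z0)).
  by rewrite scons_hd_tl.
rewrite scons_comp; have -> : p (x0 0%N) = b.
  by have := congr1 (fun u => u 0%N) x0E.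
congr (scons _ _); rewrite -(wcat_stake N.+1 (p \o z)) (eq_stake pz).
rewrite -[RHS](wcat_stake N.+1); congr (wcat _ _).
exact: (congr1 (fun u => p \o u) dz).
Qed.

(** The length [n] depends on [r] alone. Where the argument of [hlim0] leaves the factor, no lift of
    [b :: d] precedes [x], and both terms vanish. *)
Lemma hlim0_approx r : modulus [set 1%N] -> 0 < r -> exists n, forall d b x,
  size d = n -> X x ->
  `|Z (b :: d) x - hlim0 (scons b (wcat d (p \o x))) * Z d x| <= r * Z d x.
Proof.
move=> mod1 r0; have [n Hn] := osc_bound_small mod1 r0; exists n => d b x sd Xx.
have [Zd|Zd] := pselect (0 < Z d x); last first.
  have E : Z d x = 0 by exact: fiber_sum_eq0.
  have E' : Z (b :: d) x = 0.
    apply/eqP; rewrite eq_le fiber_sum_ge0 // andbT -E.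
    by apply: (fiber_sum_cat_le p [:: b] d).
  by rewrite E E' !mulr0 subrr normr0.
have [w wd Xw] := (fiber_sum_gt0P _ _ Xx).1 Zd.
have pw : wcat d (p \o x) = p \o wcat w x.
  by rewrite wcat_comp; congr (wcat _ _); apply/esym/eqP; rewrite -mem_lifts.
have [Yb|Yb] := pselect (factor_dom (scons b (wcat d (p \o x)))); last first.
  rewrite hlim0_out // mul0r subr0 (_ : Z (b :: d) x = 0) ?normr0.
    by rewrite mulr_ge0 ?fiber_sum_ge0 ?ltW.
  apply: fiber_sum_eq0 => //; apply/(fiber_sum_gt0P _ _ Xx) => -[v vd Xv]; apply: Yb.
  exists (wcat v x) => //; rewrite wcat_comp.
  by move: vd; rewrite mem_lifts => /eqP ->.
rewrite hlim0_in //; case: Yb => z Xz zE.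
have z1 : p \o sdrop 1 z = wcat d (p \o x).
  by rewrite -(sdrop_scons b (wcat _ _)) -zE.
have z0 : p (z 0%N) = b by have := congr1 (fun u => u 0%N) zE.
have dE : stake n (p \o sdrop 1 z) = d by rewrite z1 -sd stake_wcat.
have [m [M [h1 h2 h3 h4 h5]]] :=
  Hn [:: p (z 0%N)] _ erefl (gdom_sdrop 1 Xz) (fiber_sum_stake_gt0 p 1 Xz).
have /andP[g1 g2] := hlim_bnd Xz h1.
have /andP[g3 g4] := h1 x Xx; rewrite dE z0 /= in g3 g4.
rewrite -zE.
have Mm : M - m <= r.
  by apply: (le_trans h5); rewrite ler_piMr ?fiber_sum_le1 ?(ltW r0) //; exact: gdom_sdrop.
have k1 := ler_wpM2r (ltW Zd) g1; have k2 := ler_wpM2r (ltW Zd) g2.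
have k3 := ler_wpM2r (ltW Zd) Mm; rewrite mulrBl in k3.
by rewrite ler_norml; lra.
Qed.

(** The limit of [fiber_sum_sum] along the prefixes of [y], with the error divided among the
    letters. *)
Lemma hlim0_sum (y : nat -> S') : modulus [set 1%N] -> factor_dom y ->
  \sum_(b : S') hlim0 (scons b y) = 1.
Proof.
move=> mod1 [z Xz <-]; apply/eqP; rewrite -subr_eq0 -normr_le0 -normrN opprB.
apply/ler_addgt0Pl => e e0; rewrite addr0.
pose r := e / #|S'|.+1%:R.
have c0 : 0 < #|S'|.+1%:R :> R by rewrite ltr0Sn.
have r0 : 0 < r by rewrite divr_gt0.
have [n Hn] := hlim0_approx mod1 r0.
have Zd := fiber_sum_stake_gt0 p n Xz; set d := stake n _ in Zd.
have Xn := gdom_sdrop n Xz.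
rewrite -(ler_pM2r Zd) -{1}(gtr0_norm Zd) -normrM mulrBl mul1r mulr_suml.
rewrite -{1}(fiber_sum_sum p d Xn) -sumrB (le_trans (ler_norm_sum _ _ _)) //.
apply: (@le_trans _ _ (\sum_(b : S') r * Z d (sdrop n z))).
  apply: ler_sum => b _.
  have := Hn d b (sdrop n z) (size_stake _ _) Xn.
  by rewrite -sdrop_comp wcat_stake.
rewrite sumr_const -mulr_natl mulrA ler_wpM2r ?(ltW Zd) //.
rewrite /r mulrCA ler_piMr ?(ltW e0) // ler_pdivrMr // mul1r ler_nat.
exact: leqnSn.
Qed.

Definition transfer (F : (nat -> S) -> R) x : R :=
  \sum_a gfun G (scons a x) * F (scons a x).

Fixpoint all_words n : seq (seq S') :=
  if n is n'.+1 then [seq b :: d | b <- enum S', d <- all_words n'] else [:: [::]].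

Lemma size_all_words n d : d \in all_words n -> size d = n.
Proof.
elim: n d => [|n IH] d /=; first by rewrite inE => /eqP ->.
by move=> /allpairsP[[b e] /= [_ /IH <- ->]].
Qed.

Lemma iter_transfer n F x :
  iter n transfer F x = \sum_(d <- all_words n) lop d F x.
Proof.
elim: n F x => [|n IH] F x; first by rewrite big_seq1 fiber_op_nil.
rewrite iterSr IH /= big_allpairs_dep exchange_big /=.
apply: eq_bigr => d _; rewrite big_enum /=.
under [RHS]eq_bigr do rewrite (fiber_op_cat p G [:: _] d).
rewrite /fiber_op exchange_big /=; apply: eq_bigr => w _.
by rewrite -big_distrr /= fiber_op1_sum.
Qed.

Lemma fiber_sum_all_words n x : X x -> \sum_(d <- all_words n) Z d x = 1.
Proof.
move=> Xx; rewrite -iter_transfer.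
elim: n x Xx => // n IH x Xx; rewrite iterS /transfer -[RHS](gfun_sum Xx).
apply: eq_bigr => a _.
have [Xa|Xa] := pselect (X (scons a x)); first by rewrite IH ?mulr1.
by rewrite gfun_out ?mul0r.
Qed.

(** The pointwise failure of the factor map to intertwine the transfer operators of [g] and of
    [hlim0]. *)
Definition defect (f : (nat -> S') -> R) x : R :=
  \sum_(b : S') f (scons b (p \o x)) *
                (Z [:: b] x - hlim0 (scons b (p \o x))).

(** The values of [f] and [hlim0] depend only on the image word, so they leave the sum over lifts;
    what remains is estimated by [hlim0_approx]. *)
Lemma fiber_op_defect d (f : (nat -> S') -> R) x :
  lop d (defect f) x = \sum_(b : S') f (scons b (wcat d (p \o x))) *
    (Z (b :: d) x - hlim0 (scons b (wcat d (p \o x))) * Z d x).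
Proof.
transitivity (\sum_(w <- lifts p d) \sum_(b : S')
    f (scons b (wcat d (p \o x))) *
    (weight G w x * Z [:: b] (wcat w x) -
     hlim0 (scons b (wcat d (p \o x))) * (weight G w x * 1))).
  rewrite /fiber_op big_seq [RHS]big_seq; apply: eq_bigr => w wd.
  rewrite /defect mulr_sumr; apply: eq_bigr => b _.
  rewrite wcat_comp (_ : map p w = d); last by apply/eqP; rewrite -mem_lifts.
  by rewrite mulr1 mulrCA mulrBr (mulrC (weight G w x) (hlim0 _)).
rewrite exchange_big /=; apply: eq_bigr => b _.
by rewrite -mulr_sumr sumrB -mulr_sumr [Z (b :: d) x](fiber_op_cat p G [:: b] d).
Qed.

Lemma defect_small (f : (nat -> S') -> R) B r : modulus [set 1%N] ->
  (forall y : nat -> S', `|f y| <= B) ->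
  0 < r -> exists n, forall x, X x -> `|iter n transfer (defect f) x| <= r.
Proof.
move=> mod1 fB r0.
pose B1 := `|B| + 1; have B10 : 0 < B1 by rewrite ltr_wpDl.
have fB1 (y : nat -> S') : `|f y| <= B1.
  by apply: (le_trans (fB y)); rewrite (le_trans (ler_norm _)) // lerDl.
have c0 : 0 < #|S'|.+1%:R :> R by rewrite ltr0Sn.
have [q [q0 qE]] : exists q, 0 < q /\ #|S'|.+1%:R * B1 * q = r.
  exists (r / (#|S'|.+1%:R * B1)); split; first by rewrite divr_gt0 ?mulr_gt0.
  by rewrite mulrCA divff ?mulr1 // lt0r_neq0 // mulr_gt0.
have [n Hn] := hlim0_approx mod1 q0; exists n => x Xx.
rewrite iter_transfer (le_trans (ler_norm_sum _ _ _)) //.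
rewrite -[leRHS]mulr1 -(fiber_sum_all_words n Xx) mulr_sumr big_seq [leRHS]big_seq.
apply: ler_sum => d /size_all_words sd.
rewrite fiber_op_defect (le_trans (ler_norm_sum _ _ _)) //.
apply: (@le_trans _ _ (\sum_(b : S') B1 * (q * Z d x))).
  by apply: ler_sum => b _; rewrite normrM ler_pM // Hn.
rewrite sumr_const -mulr_natl !mulrA ler_wpM2r ?fiber_sum_ge0 //.
apply: (@le_trans _ _ (#|S'|.+1%:R * B1 * q)).
  by rewrite !ler_wpM2r ?ler_nat ?(ltW q0) ?(ltW B10).
by rewrite qE.
Qed.

End Mixing.

(** * Topology and integration on shift spaces *)

Section Cylinders.
Context {S : finType}.

Lemma nbhs_cyl (x : full_shift S) n :
  nbhs x [set y : full_shift S | agree n x y].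
Proof.
elim: n => [|n IH].
  have -> : [set y : full_shift S | agree 0 x y] = setT by apply/seteqP; split.
  exact: filterT.
apply: filterS (filterI IH (nbhs_coord x n)) => y [/= xy yx] i.
by rewrite ltnS leq_eqVlt => /predU1P[->|/xy].
Qed.

(** The filter generated by the cylinders around [x] converges to [x], since it does so in each
    coordinate. *)
Lemma nbhs_cylE (x : full_shift S) (U : set (full_shift S)) :
  nbhs x U -> exists n, forall y, agree n x y -> U y.
Proof.
pose F := filter_from setT (fun n => [set y : full_shift S | agree n x y]).
have FF : Filter F.
  apply: filter_from_filter; first by exists 0%N.
  move=> i j _ _; exists (maxn i j) => // y /= xy; split => k ki; apply: xy.
    by rewrite (leq_trans ki) // leq_maxl.
  by rewrite (leq_trans ki) // leq_maxr.
have Fx : F --> x.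
  apply/cvg_sup => i A [_ [[B oB <-] Bpx] sBA].
  exists i.+1 => // y xy; apply: sBA => /=.
  by rewrite /preimage /= /proj -(xy i (ltnSn i)).
by move=> /Fx[n _ nU]; exists n.
Qed.

Lemma compact_full_shift : compact [set: full_shift S].
Proof.
have -> : [set: full_shift S] =
    [set f : full_shift S | forall i, [set: discrete_topology S] (f i)].
  by apply/seteqP; split.
apply: (@tychonoff nat (fun=> discrete_topology S) (fun=> setT)) => _.
apply: finite_compact; exact: (@finite_finset S setT).
Qed.

End Cylinders.

Section Spaces.
Context {R : realType} {S : finType} (X : shift_space S).
Implicit Types (x y : X) (F : X -> R).

Definition mkpt (z : nat -> S) (h : carrier X z) : X := SigSub (mem_set h).

Definition ext F (z : nat -> S) : R :=
  if pselect (carrier X z) is left h then F (mkpt h) else 0.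

Lemma coords_in x : carrier X (coords x).
Proof. exact: set_valP. Qed.

Lemma coords_mkpt z (h : carrier X z) : coords (mkpt h) = z.
Proof. by []. Qed.

Lemma coords_inj x y : coords x = coords y -> x = y.
Proof. by move=> xy; apply: val_inj. Qed.

Lemma mkpt_coords x (h : carrier X (coords x)) : mkpt h = x.
Proof. exact: coords_inj. Qed.

Lemma ext_mkpt F z (h : carrier X z) : ext F z = F (mkpt h).
Proof.
by rewrite /ext; case: pselect => // h'; congr F; exact: coords_inj.
Qed.

Lemma ext_coords F x : ext F (coords x) = F x.
Proof. by rewrite (ext_mkpt F (coords_in x)) mkpt_coords. Qed.

Lemma ext_out F z : ~ carrier X z -> ext F z = 0.
Proof. by rewrite /ext; case: pselect. Qed.

Lemma coords_shift x : coords (shift x) = sdrop 1 (coords x).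
Proof. by []. Qed.

Lemma coords_iter n x : coords (iter n (@shift S X) x) = sdrop n (coords x).
Proof.
elim: n x => [|n IH] x; first by rewrite sdrop0.
by rewrite iterS coords_shift IH sdropD addn1.
Qed.

Lemma nbhs_cylX x n : nbhs x [set y : X | agree n (coords x) (coords y)].
Proof.
have := nbhs_cyl (coords x : full_shift S) n.
exact: (@initial_continuous _ _ (set_val : carrier X -> full_shift S) x).
Qed.

Lemma nbhs_cylXE x (U : set X) : nbhs x U ->
  exists n, forall y, agree n (coords x) (coords y) -> U y.
Proof.
move=> [_ [[B oB <-] Bx] sB].
have [n Hn] : exists n, forall z, agree n (coords x) z -> B z.
  by apply: (@nbhs_cylE S (coords x)); exact: open_nbhs_nbhs.
by exists n => y /Hn By; exact: sB.
Qed.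

Lemma continuous_cyl F : continuous F <-> forall x e, 0 < e -> exists n,
  forall y, agree n (coords x) (coords y) -> `|F x - F y| <= e.
Proof.
split=> [cF x e e0|H x].
  by have /cvgrPdist_le/(_ _ e0)/nbhs_cylXE := cF x.
have FF : Filter (nbhs x) by exact: nbhs_filter.
apply/(cvgrPdist_le (FF := FF)) => e e0; have [n Hn] := H x e e0.
by apply: (@filterS X (nbhs x) (nbhs_filter x) _ _ _ (nbhs_cylX x n)) => y; exact: Hn.
Qed.

Lemma continuous_measurable F : continuous F -> measurable_fun [set: X] F.
Proof.
move=> /continuousP cF; apply: (measurability _ (RGenOpens.measurableE R)).
move=> _ [_ [a [b ->] <-]]; rewrite setTI; apply: sub_sigma_algebra.
exact/cF/interval_open.
Qed.

(** A preimage is determined by its first letter; letters that cannot precede [x] contribute the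
    default value 0 of [ext]. *)
Lemma preimage_sum F x :
  \sum_(y \in [set y | shift y = x]) F y = \sum_a ext F (scons a (coords x)).
Proof.
pose h (a : S) : X := if pselect (carrier X (scons a (coords x))) is left k
  then mkpt k else x.
pose P := [set a | carrier X (scons a (coords x))].
have hP a (k : P a) : h a = mkpt k.
  by rewrite /h; case: pselect => // k'; exact: coords_inj.
rewrite (@reindex_fsbig _ _ _ _ _ h P); last first.
  split => [a /= k|a b /set_mem ka /set_mem kb|y /= yx].
  - by rewrite (hP _ k); apply: coords_inj; rewrite coords_shift coords_mkpt sdrop_scons.
  - rewrite (hP _ ka) (hP _ kb) => E.
    exact: (congr1 (fun y : X => coords y 0%N) E).
  - have k : P (coords y 0%N).
      by rewrite /P /= -yx coords_shift scons_hd_tl; exact: coords_in.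
    exists (coords y 0%N) => //; rewrite (hP _ k); apply: coords_inj.
    by rewrite coords_mkpt -yx coords_shift scons_hd_tl.
transitivity (\sum_(a \in P) ext F (scons a (coords x))).
  by apply: eq_fsbigr => a /set_mem k; rewrite (hP _ k) (ext_mkpt F k).
rewrite (fsbig_widen P setT) //; last by move=> a [_ nP]; rewrite /= ext_out.
rewrite fsbig_finite //= (perm_big (enum S)) ?big_enum //=.
apply: uniq_perm; [exact: finmap.fset_uniq|exact: enum_uniq|move=> a].
by rewrite mem_enum in_fset_set; [rewrite classical_sets.in_setT|exact: finite_finset].
Qed.

(** Stated with a general memory [M] so as to cover the subshift, with [M = 1], and its factor, with
    [M = N.+1]. *)
Definition markov M := forall a z z', carrier X z -> carrier X z' ->
  agree M z z' -> carrier X (scons a z) -> carrier X (scons a z').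

(** Points sharing [M] letters are preceded by the same letters, so the sums can be compared letter
    by letter. *)
Lemma preimage_sum_continuous M F : markov M -> continuous F ->
  continuous (fun x => \sum_(y \in [set y | shift y = x]) F y).
Proof.
move=> mX /continuous_cyl cF; apply/continuous_cyl => x e e0.
have c0 : 0 < #|S|.+1%:R :> R by rewrite ltr0Sn.
pose q := e / #|S|.+1%:R; have q0 : 0 < q by rewrite divr_gt0.
have Hn a : exists n, forall y, agree n (coords x) (coords y) ->
    `|ext F (scons a (coords x)) - ext F (scons a (coords y))| <= q.
  have [h|h] := pselect (carrier X (scons a (coords x))).
    have [n Hn] := cF (mkpt h) q q0; exists (maxn M n) => y xy.
    have h' : carrier X (scons a (coords y)).
      apply: (mX a (coords x) (coords y) _ _ _ h); try exact: coords_in.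
      by apply: agree_le xy; rewrite leq_maxl.
    rewrite (ext_mkpt F h) (ext_mkpt F h'); apply: Hn.
    rewrite !coords_mkpt; apply: (@agree_le _ _ (size [:: a] + n)).
      by rewrite leq_addl.
    apply: (@agree_wcat _ [:: a]).
    by apply: agree_le xy; rewrite leq_maxr.
  exists M => y xy; rewrite !ext_out ?subrr ?normr0 ?(ltW q0) // => h'.
  apply: h; apply: mX h'; [exact: coords_in|exact: coords_in|].
  exact: agree_sym.
have [n nP] := choice Hn.
exists (\max_a n a) => y xy; rewrite !preimage_sum -sumrB.
apply: (le_trans (ler_norm_sum _ _ _)).
apply: (@le_trans _ _ (\sum_(a : S) q)).
  apply: ler_sum => a _; apply: nP; apply: agree_le xy.
  exact: leq_bigmax.
rewrite sumr_const -mulr_natl /q mulrCA ler_piMr ?(ltW e0) //.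
by rewrite ler_pdivrMr // mul1r ler_nat.
Qed.

End Spaces.

(** * Compactness of subshifts of finite type *)

Section Compactness.
Context {R : realType} {S : finType} (A : rel S) (neA : sft_set A !=set0).
Local Notation X := (sft neA).

(** Compactness in the form needed to refute a failure of uniformity: [P n] collects the failures at
    level [n]. *)
Lemma sft_cluster (P : nat -> set X) : (forall m n, (m <= n)%N -> P n `<=` P m) ->
  (forall n, P n !=set0) ->
  exists z : X, forall n m, exists2 x, P n x & agree m (coords z) (coords x).
Proof.
move=> Pdec P0; pose B n := [set z : full_shift S | exists2 x, P n x & coords x = z].
pose F := filter_from setT B.
have FF : ProperFilter F.
  apply: filter_from_proper; last first.
    by move=> n _; have [x Px] := P0 n; exists (coords x), x.
  apply: filter_from_filter; first by exists 0%N.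
  move=> i j _ _; exists (maxn i j) => // z [x Px xz]; split; exists x => //.
    by apply: Pdec Px; rewrite leq_maxl.
  by apply: Pdec Px; rewrite leq_maxr.
have FT : F setT by exists 0%N.
have [z [_ zF]] := compact_full_shift FF FT.
have H n m : exists2 x : X, P n x & agree m z (coords x).
  have FB : F (B n) by exists n.
  have [_ [[x Px <-] zx]] := zF _ _ FB (nbhs_cyl z m).
  by exists x.
suff Xz : carrier X z by exists (mkpt Xz) => n m; rewrite coords_mkpt.
move=> i; have [x _ zx] := H 0%N i.+2.
by rewrite (zx i) // (zx i.+1) //; exact: (coords_in x).
Qed.

Lemma sft_uniform (F : X -> R) e : continuous F -> 0 < e ->
  exists n, forall x y : X, agree n (coords x) (coords y) -> `|F x - F y| <= e.
Proof.
move=> /continuous_cyl cF e0; apply: contrapT => /forallNP H.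
pose P n := [set x : X | exists2 y : X, agree n (coords x) (coords y) & e < `|F x - F y|].
have [||z Hz] := @sft_cluster P.
- by move=> m n mn x [y xy Fxy]; exists y => //; exact: agree_le xy.
- move=> n; have /existsNP[x /existsNP[y /not_implyP[xy /negP]]] := H n.
  by rewrite -ltNge => Fxy; exists x, y.
have e20 : 0 < e / 2 by rewrite divr_gt0.
have [n Hn] := cF z _ e20; have [x [y xy Fxy] zx] := Hz n n.
have := Hn x zx; have := Hn y (agree_trans zx xy).
move: Fxy; rewrite (_ : F x - F y = (F z - F y) - (F z - F x)); last by ring.
by have := ler_normB (F z - F y) (F z - F x); lra.
Qed.

Lemma sft_bounded (F : X -> R) : continuous F -> exists B, forall x, `|F x| <= B.
Proof.
move=> /continuous_cyl cF; apply: contrapT => /forallNP H.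
have [||z Hz] := @sft_cluster (fun n => [set x | n%:R < `|F x|]).
- by move=> m n mn x; apply: le_lt_trans; rewrite ler_nat.
- by move=> n; have /existsNP[x /negP] := H n%:R; rewrite -ltNge; exists x.
have [n Hn] := cF z 1 ltr01.
have [x /= Fx zx] := Hz (Num.trunc (`|F z| + 1)).+1 n.
have := Hn x zx; have := truncnS_gt (`|F z| + 1); move: Fx.
have := ler_normB (F z) (F z - F x); rewrite opprB addrC subrK.
lra.
Qed.

End Compactness.

Section Measure.
Context {R : realType} {S : finType} (X : shift_space S) (mu : probability X R).
Implicit Types F : X -> R.

Lemma continuous_integrable F B : continuous F -> (forall x, `|F x| <= B) ->
  mu.-integrable [set: X] (EFin \o F).
Proof.
move=> cF FB; apply: measurable_bounded_integrable => //.
- by apply: le_lt_trans (ltry 1); rewrite probability_le1.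
- exact: continuous_measurable.
- exists B; split; first exact: num_real.
  by move=> M BM x _ /=; apply: le_trans (FB x) (ltW BM).
Qed.

Lemma integral_small F r : continuous F -> 0 <= r -> (forall x, `|F x| <= r) ->
  (`|\int[mu]_x (F x)%:E| <= r%:E)%E.
Proof.
move=> cF r0 Fr; have mF := continuous_measurable cF.
apply: le_trans (le_abse_integral _ _ _) _ => //; first exact/measurable_EFinP.
have -> : (r%:E = r%:E * mu [set: X])%E by rewrite probability_setT mule1.
apply: integral_le_bound => //; first exact/measurable_EFinP.
by apply: aeW => x _ /=; rewrite lee_fin.
Qed.

Lemma integral_cstT (r : R) : (\int[mu]_x r%:E = r%:E)%E.
Proof.
rewrite integral_cst // -[RHS]mule1; congr (_ * _)%E.
exact: probability_setT.
Qed.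

End Measure.

(** * The transfer operator and the support of the measure *)

Section TransferOperator.
Context {R : realType} {S : finType} (A : rel S) (neA : sft_set A !=set0).
Local Notation X := (sft neA).
Context (g : X -> R) (gfn : is_g_function g).

Lemma sft_markov : markov X 1.
Proof.
move=> a z z' Xz Xz' zz' Xaz [|i]; last exact: Xz'.
by have := Xaz 0%N; rewrite /= (zz' 0%N).
Qed.

(** The reciprocal of [g] is continuous, hence bounded. *)
Lemma g_lower_bound : exists c, [/\ 0 < c, c <= 1 & forall x, c <= g x].
Proof.
have [cg g01 _] := gfn.
have cV : continuous (fun x : X => (g x)^-1).
  move=> x; have gx : g x != 0 by have /andP[/lt0r_neq0] := g01 x.
  exact: cvgV gx (cg x).
have [B HB] := sft_bounded cV.
have B1 : 0 < `|B| + 1 by rewrite ltr_wpDl.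
exists (Num.min 1 (`|B| + 1)^-1); split.
- by rewrite lt_min ltr01 invr_gt0.
- by rewrite ge_min lexx.
move=> x; rewrite ge_min; apply/orP; right; have /andP[g0 _] := g01 x.
rewrite -[g x]invrK lef_pV2 ?posrE ?invr_gt0 //.
have := HB x; rewrite gtr0_norm ?invr_gt0 // => h.
by rewrite (le_trans h) // (le_trans (ler_norm _)) // lerDl.
Qed.

Lemma sft_gsystem : exists G : gsystem R S,
  gdom G = sft_set A /\ gfun G = ext g.
Proof.
have [c [c0 c1 gc]] := g_lower_bound; have [_ _ gs] := gfn.
have Xcons a (x y : nat -> S) : sft_set A x -> sft_set A y -> x 0%N = y 0%N ->
    sft_set A (scons a x) -> sft_set A (scons a y).
  by move=> Xx Xy xy; apply: (@sft_markov a x y) => // -[].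
have gout (x : nat -> S) : ~ sft_set A x -> ext g x = 0
    by exact: (@ext_out R S X g x).
have gge (x : nat -> S) : sft_set A x -> c <= ext g x.
  by move=> Xx; rewrite (@ext_mkpt _ _ X g x Xx).
have gsum (x : nat -> S) : sft_set A x -> \sum_a ext g (scons a x) = 1.
  move=> Xx; rewrite -(gs (@mkpt _ X x Xx)).
  by rewrite preimage_sum.
by exists (@GSystem R S (sft_set A) (ext g) c Xcons
  (@sft_set_shift S A) gout c0 c1 gge gsum).
Qed.

Definition ltransfer (F : X -> R) (x : X) : R :=
  \sum_(y \in [set y | shift y = x]) (g y * F y).

Lemma ltransfer_continuous F : continuous F -> continuous (ltransfer F).
Proof.
have [cg _ _] := gfn => cF; apply: (preimage_sum_continuous sft_markov) => x.
exact: (cvgM (cg x) (cF x)).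
Qed.

Context (G : gsystem R S) (GX : gdom G = sft_set A) (Gg : gfun G = ext g).

Lemma iter_ltransfer n F x :
  iter n ltransfer F x = iter n (transfer G) (ext F) (coords x).
Proof.
have tE F1 y : transfer G F1 y = \sum_a ext g (scons a y) * F1 (scons a y).
  by rewrite /transfer Gg.
elim: n x => [|n IH] x; first by rewrite /= ext_coords.
rewrite !iterS tE /ltransfer preimage_sum; apply: eq_bigr => a _.
have [h|h] := pselect (carrier X (scons a (coords x))).
  by rewrite !(ext_mkpt _ h) IH coords_mkpt.
by rewrite !ext_out // mul0r.
Qed.

Lemma iter_transfer_eq n F F' z : gdom G z ->
  (forall y, gdom G y -> F y = F' y) ->
  iter n (transfer G) F z = iter n (transfer G) F' z.
Proof.
move=> + FF'; elim: n z => [|n IH] z Xz; first exact: FF'.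
rewrite !iterS; apply: eq_bigr => a _.
have [h|h] := pselect (gdom G (scons a z)); first by rewrite IH.
by rewrite gfun_out // !mul0r.
Qed.

Lemma iter_transfer_ge0 n F z : gdom G z -> (forall y, gdom G y -> 0 <= F y) ->
  0 <= iter n (transfer G) F z.
Proof.
move=> + F0; elim: n z => [|n IH] z Xz; first exact: F0.
rewrite iterS sumr_ge0 // => a _.
have [h|h] := pselect (gdom G (scons a z)); last by rewrite gfun_out // mul0r.
by rewrite mulr_ge0 ?gfun_ge0 // IH.
Qed.

Lemma iter_transfer_ge n F z : gdom G z -> (forall y, gdom G y -> 0 <= F y) ->
  gmin G ^+ n * F z <= iter n (transfer G) F (sdrop n z).
Proof.
move=> Xz F0; elim: n => [|n IH]; first by rewrite mul1r sdrop0.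
have Xn := gdom_sdrop n Xz.
rewrite iterS /transfer (bigD1 (z n)) //=.
have -> : scons (z n) (sdrop n.+1 z) = sdrop n z.
  by rewrite -[RHS]scons_hd_tl sdropD addn1 /sdrop addn0.
rewrite exprS -mulrA (le_trans (ler_pM _ _ (gfun_ge Xn) IH)) //.
- exact/ltW/gmin_gt0.
- by rewrite mulr_ge0 ?F0 // exprn_ge0 //; exact/ltW/gmin_gt0.
rewrite lerDl sumr_ge0 // => a _.
have [h|h] := pselect (gdom G (scons a (sdrop n.+1 z))).
  by rewrite mulr_ge0 ?gfun_ge0 ?iter_transfer_ge0.
by rewrite gfun_out // mul0r.
Qed.

(** Only the first letter of [x] matters: an orbit from the cylinder of [x0] that shows this letter
    at time [n] can have its tail replaced by [x]. Finitely many letters give a common [n]. *)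
Lemma mixing_reach (x0 : X) l : topologically_mixing X -> exists n,
  forall x : X, exists z, [/\ gdom G z, agree l (coords x0) z & sdrop n z = coords x].
Proof.
move=> mixA; pose C (x : X) n := [set y : X | agree n (coords x) (coords y)].
have oC x n : open (C x n).
  rewrite openE => y xy.
  apply: (@filterS X (nbhs y) (nbhs_filter y) _ _ _ (nbhs_cylX y n)) => t.
  exact: agree_trans.
have HN (a : S) : exists N, forall x : X, coords x 0%N = a -> forall n, (N <= n)%N ->
    exists z : X, agree l (coords x0) (coords z) /\ coords z n = a.
  have [[x xa]|nx] := pselect (exists x : X, coords x 0%N = a); last first.
    by exists 0%N => x xa; case: nx; exists x.
  have [||N HN] := mixA (C x0 l) (C x 1%N) (oC x0 l) _ (oC x 1%N).
  - by exists x0.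
  - by exists x.
  exists N => _ _ n /HN[z [z0 zn]]; exists z; split => //.
  have := zn 0%N isT; rewrite coords_iter xa => ->.
  by rewrite /sdrop addn0.
(* The summand [l] ensures that replacing the tail leaves the first [l] letters intact. *)
have [N NP] := choice HN; exists (l + \max_a N a)%N => x.
have [|z [x0z zn]] := NP (coords x 0%N) x erefl (l + \max_a N a)%N.
  by rewrite (leq_trans (leq_bigmax _)) // leq_addl.
set n := (_ + _)%N in zn *.
exists (wcat (stake n (coords z)) (coords x)); split.
- have Xz : gdom G (coords z) by rewrite GX; exact: (coords_in z).
  apply: (@gdom_wcat _ _ G _ (sdrop n (coords z))).
  + exact: gdom_sdrop.
  + by rewrite GX; exact: (coords_in x).
  + by rewrite /sdrop addn0.
  + by rewrite wcat_stake.
- apply: (agree_trans x0z); apply: (@agree_le _ _ n); first by rewrite leq_addr.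
  rewrite -{1}(wcat_stake n (coords z)) -{1}(addn0 n) -{1}(size_stake n (coords z)).
  exact: agree_wcat.
- by rewrite -{1}(size_stake n (coords z)) sdrop_wcat.
Qed.

Context (mu : probability X R) (gmu : is_g_measure_for mu g).

Lemma integral_iter_ltransfer n (F : X -> R) : continuous F ->
  (\int[mu]_x (iter n ltransfer F x)%:E = \int[mu]_x (F x)%:E)%E /\
  continuous (iter n ltransfer F).
Proof.
move=> cF; elim: n => [|n [IH cIH]] //; split.
  by rewrite iterS -IH; have [_ ->] := gmu.
by rewrite iterS; exact: ltransfer_continuous.
Qed.

(** Every point has an [n]-th preimage in a cylinder where [F] is at least half of [F x0], so the
    [n]-th transfer of [F], which has the same integral, is bounded below by a positive constant. *)
Lemma integral_gt0 (F : X -> R) x0 : topologically_mixing X -> continuous F ->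
  (forall x, 0 <= F x) -> 0 < F x0 -> (0 < \int[mu]_x (F x)%:E)%E.
Proof.
move=> mixA cF F0 Fx0.
have e0 : 0 < F x0 / 2 by rewrite divr_gt0.
have [l Hl] := (continuous_cyl F).1 cF x0 _ e0.
have [n Hn] := mixing_reach x0 l mixA.
have [<- cn] := integral_iter_ltransfer n cF.
pose c := gmin G ^+ n * (F x0 / 2).
have c0 : 0 < c by rewrite mulr_gt0 // exprn_gt0 // gmin_gt0.
have F0' (y : nat -> S) : gdom G y -> 0 <= ext F y.
  by rewrite GX => Xy; rewrite (@ext_mkpt _ _ X F y Xy).
apply: (@lt_le_trans _ _ (\int[mu]_x c%:E)%E).
  by rewrite integral_cstT lte_fin.
apply: ge0_le_integral => //.
- by move=> x _; rewrite lee_fin ltW.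
- by apply/measurable_EFinP; exact: continuous_measurable.
move=> x _; rewrite lee_fin iter_ltransfer.
have [z [Xz x0z <-]] := Hn x.
apply: le_trans (iter_transfer_ge n Xz F0').
rewrite /c ler_wpM2l ?exprn_ge0 ?(ltW (gmin_gt0 G)) //.
have Xz' : carrier X z by move: Xz; rewrite GX.
rewrite (ext_mkpt F Xz').
have := Hl (mkpt Xz'); rewrite coords_mkpt => /(_ x0z); rewrite ler_norml.
lra.
Qed.

End TransferOperator.

(** * Regularity classes *)

Section RegularityReal.
Context {R : realType} {S : finType} (X : shift_space S).
Implicit Types (phi f : X -> R) (x y : X).
Local Notation Sn := birkhoff_sum.

Lemma var_leP n phi r : (var n phi <= r%:E)%E <->
  forall x y, agree n (coords x) (coords y) -> `|phi x - phi y| <= r.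
Proof.
split=> [H x y xy|H].
  rewrite -lee_fin; apply: le_trans H; apply: ereal_sup_ubound.
  by exists (x, y).
by apply: ge_ereal_sup => _ [[x y] /= xy <-]; rewrite lee_fin; exact: H.
Qed.

Lemma var_ge0 n phi : (0 <= var n phi)%E.
Proof.
apply: ereal_sup_ubound; exists (point, point) => //=.
by rewrite subrr normr0.
Qed.

Lemma birkhoff0 phi x : Sn 0 phi x = 0.
Proof. by rewrite /birkhoff_sum big_geq. Qed.

Lemma birkhoff1 phi x : Sn 1 phi x = phi x.
Proof. by rewrite /birkhoff_sum big_nat1. Qed.

Lemma BowenP phi : Bowen phi <-> continuous phi /\ exists K, 0 <= K /\
  forall n x y, agree n (coords x) (coords y) -> `|Sn n phi x - Sn n phi y| <= K.
Proof.
split=> [[cphi [K HK]]|[cphi [K [K0 HK]]]]; split => //.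
  exists `|K|; split => // -[|n] x y xy.
    by rewrite !birkhoff0 subrr normr0.
  apply: le_trans (ler_norm K); move: x y xy; apply/var_leP.
  by apply: le_trans HK; apply: ereal_sup_ubound; exists n.+1.
exists K; apply: ge_ereal_sup => _ [n _ <-]; apply/var_leP; exact: HK.
Qed.

Lemma WaltersP phi : Walters phi <-> forall e, 0 < e -> exists k, forall n x y,
  agree (n + k) (coords x) (coords y) -> `|Sn n phi x - Sn n phi y| <= e.
Proof.
rewrite /Walters; set s := (s in s @ \oo --> _); split=> [H e e0|H].
  have : nbhs (0%:E : \bar R) [set u | (u <= e%:E)%E].
    exists e => //= r; rewrite /ball_ /= sub0r normrN => re.
    by rewrite lee_fin (le_trans (ler_norm r)) // ltW.
  move=> /H[k _ Hk]; exists k => -[|n] x y xy.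
    by rewrite !birkhoff0 subrr normr0 ltW.
  move: x y xy; apply/var_leP; apply: le_trans (Hk k (leqnn k)).
  by apply: ereal_sup_ubound; exists n.+1.
move=> A [e /= e0 eA].
have e20 : 0 < e / 2 by rewrite divr_gt0.
have [k Hk] := H _ e20; exists k => // j /= kj.
have s0 : (0 <= s j)%E.
  apply: le_trans (var_ge0 (1 + j)%N (Sn 1 phi)) _.
  by apply: ereal_sup_ubound; exists 1%N.
have se : (s j <= (e / 2)%:E)%E.
  apply: ge_ereal_sup => _ [n _ <-]; apply/var_leP => x y xy; apply: Hk.
  by apply: agree_le xy; rewrite leq_add2l.
case: (s j) s0 se => [r| |] //=; rewrite !lee_fin => r0 re.
by apply: eA; rewrite /ball_ /= sub0r normrN ger0_norm //; lra.
Qed.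

Lemma birkhoff_ln f n x : (forall x, 0 < f x) ->
  Sn n (fun x => ln (f x)) x = ln (\prod_(0 <= i < n) f (iter i (@shift S X) x)).
Proof.
move=> f0; elim: n => [|n IH]; first by rewrite birkhoff0 big_geq // ln1.
rewrite /birkhoff_sum in IH *; rewrite !big_nat_recr //= IH lnM //.
  by rewrite posrE prodr_gt0.
by rewrite posrE.
Qed.

(** The first [n - k] terms of the sum are controlled by the Walters condition, the last [k] by the
    supremum of [phi]. *)
Lemma Walters_Bowen phi : continuous phi -> (exists B, forall x, `|phi x| <= B) ->
  Walters phi -> Bowen phi.
Proof.
move=> cphi [B HB] /WaltersP /(_ 1 ltr01)[k Hk]; apply/BowenP; split => //.
have SB n x : `|Sn n phi x| <= n%:R * B.
  rewrite /birkhoff_sum (le_trans (ler_norm_sum _ _ _)) //.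
  apply: (@le_trans _ _ (\sum_(0 <= i < n) B)); first exact: ler_sum.
  by rewrite sumr_const_nat subn0 mulr_natl.
have B0 : 0 <= B by exact: le_trans (normr_ge0 _) (HB point).
exists (1 + 2 * (k%:R * B)); split.
  by rewrite addr_ge0 // !mulr_ge0.
move=> n x y xy; have [nk|kn] := leqP n k.
  apply: (le_trans (ler_normB _ _)).
  have := SB n x; have := SB n y.
  have : n%:R * B <= k%:R * B by rewrite ler_wpM2r // ler_nat.
  by lra.
have E z : Sn n phi z = Sn (n - k)%N phi z + Sn k phi (iter (n - k)%N (@shift S X) z).
  rewrite /birkhoff_sum (@big_cat_nat _ _ _ (n - k)%N) ?leq_subr //=; congr (_ + _).
  rewrite -{1}[(n - k)%N]add0n big_addn subKn ?(ltnW kn) //.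
  by apply: eq_bigr => i _; rewrite iterD.
rewrite !E (_ : _ - _ = (Sn (n - k)%N phi x - Sn (n - k)%N phi y) +
  (Sn k phi (iter (n - k)%N (@shift S X) x) - Sn k phi (iter (n - k)%N (@shift S X) y)));
  last by ring.
apply: (le_trans (ler_normD _ _)); apply: lerD.
  by apply: Hk; rewrite subnK // ltnW.
apply: (le_trans (ler_normB _ _)).
have := SB k (iter (n - k)%N (@shift S X) x).
have := SB k (iter (n - k)%N (@shift S X) y); lra.
Qed.

Lemma Holder_birkhoff phi : Holder phi -> exists C theta : R,
  [/\ 0 < theta < 1, 0 <= C & forall n j x y,
  agree (n + j) (coords x) (coords y) ->
  `|Sn n phi x - Sn n phi y| <= C * theta ^+ j].
Proof.
move=> [C [t [/andP[t0 t1] harnackC]]].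
have C0 : 0 <= C.
  by have := le_trans (var_ge0 0 phi) (harnackC 0%N); rewrite lee_fin expr0 mulr1.
exists (C / (1 - t)), t; split; first by rewrite t0.
  by rewrite divr_ge0 // subr_ge0 ltW.
have tX i : 0 <= t ^+ i by rewrite exprn_ge0 // ltW.
have d0 : 0 < 1 - t by rewrite subr_gt0.
move=> n j x y xy.
(* The partial geometric sum is kept so that the induction closes. *)
suff : `|Sn n phi x - Sn n phi y| <= C / (1 - t) * (t ^+ j * (1 - t ^+ n)).
  move=> h; apply: (le_trans h).
  rewrite ler_wpM2l ?divr_ge0 ?(ltW d0) // ler_piMr // lerBlDr lerDl //.
elim: n x y xy => [|n IH] x y xy.
  by rewrite !birkhoff0 subrr normr0 expr0 subrr !mulr0.
have E z : Sn n.+1 phi z = phi z + Sn n phi (shift z).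
  rewrite /birkhoff_sum big_nat_recl //=; congr (_ + _).
  by apply: eq_bigr => i _; rewrite -iterSr.
rewrite !E (_ : _ - _ = (phi x - phi y) + (Sn n phi (shift x) - Sn n phi (shift y)));
  last by ring.
apply: (le_trans (ler_normD _ _)).
have h1 : `|phi x - phi y| <= C * t ^+ (n.+1 + j).
  by move: x y xy; apply/var_leP.
have h3 : C * t ^+ (n.+1 + j) <= C * t ^+ (n + j).
  by rewrite ler_wpM2l // ler_wiXn2l ?(ltW t0) ?(ltW t1) // leq_add2r.
have h2 := IH (shift x) (shift y) (@agree_sdrop _ 1 _ _ _ xy).
apply: (le_trans (lerD (le_trans h1 h3) h2)).
rewrite le_eqVlt; apply/orP; left; apply/eqP.
have d1 : 1 - t != 0 by rewrite lt0r_neq0.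
by rewrite exprD exprS; field.
Qed.

Lemma Holder_Walters phi : Holder phi -> Walters phi.
Proof.
move=> /Holder_birkhoff[C [t [/andP[t0 t1] C0 H]]]; apply/WaltersP => e e0.
have C1 : 0 < C + 1 by rewrite ltr_wpDl.
have [||j Hj] := @expr_small R t (e / (C + 1)); first by rewrite ltW.
  by rewrite divr_gt0.
exists j => n x y xy; apply: (le_trans (H n j x y xy)).
have tj : 0 <= t ^+ j by rewrite exprn_ge0 // ltW.
have : t ^+ j * (C + 1) <= e by rewrite -ler_pdivlMr.
lra.
Qed.

End RegularityReal.

(** * From regularity of [ln g] to distortion *)

Section Distortion.
Context {R : realType} {S S' : finType} (A : rel S) (neA : sft_set A !=set0).
Local Notation X := (sft neA).
Context (g : X -> R) (gfn : is_g_function g).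
Context (G : gsystem R S) (GX : gdom G = sft_set A) (Gg : gfun G = ext g).
Local Notation lng := (fun x : X => ln (g x)).

Let g_gt0 x : 0 < g x.
Proof. by have [_ /(_ x)/andP[]] := gfn. Qed.

Lemma gprod_birkhoff n (x : X) :
  gprod G n (coords x) = expR (birkhoff_sum n lng x).
Proof.
rewrite birkhoff_ln // lnK; last by rewrite posrE prodr_gt0.
rewrite /gprod; apply: eq_bigr => i _.
by rewrite Gg -coords_iter ext_coords.
Qed.

Lemma distortion_birkhoff n j t tau : (forall x y : X,
    agree (n + j) (coords x) (coords y) ->
    `|birkhoff_sum n lng x - birkhoff_sum n lng y| <= t) ->
  expR t <= tau -> distortion G n j tau.
Proof.
move=> H ttau z z'; rewrite GX => Xz Xz' zz'.
have h := H (@mkpt _ X z Xz) (@mkpt _ X z' Xz') zz'.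
rewrite -[z](@coords_mkpt _ X z Xz) -[z'](@coords_mkpt _ X z' Xz').
rewrite !gprod_birkhoff; apply: le_trans (ler_wpM2r (expR_ge0 _) ttau).
rewrite -expRD ler_expR; move: h; rewrite ler_norml; lra.
Qed.

Lemma ln_g_continuous : continuous lng.
Proof.
have [cg _ _] := gfn => x.
by apply: (@continuous_comp _ _ _ g (@ln R)); [exact: cg|exact: continuous_ln].
Qed.

(* Over boundedly many steps uniform continuity suffices. *)
Lemma modulus1 : modulus G [set 1%N].
Proof.
move=> k r r0.
(* The products to be compared have [1 + k] and [k] factors. *)
have e0 : 0 < ln (1 + r) / k.+1%:R by rewrite divr_gt0 // ln_gt0 // ltrDl.
have [j Hj] := sft_uniform ln_g_continuous e0.
have H n : (n <= k.+1)%N -> distortion G n j (1 + r).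
  move=> nk; apply: (@distortion_birkhoff _ _ (ln (1 + r))); last first.
    by rewrite lnK // posrE addr_gt0.
  move=> x y xy; rewrite /birkhoff_sum -sumrB (le_trans (ler_norm_sum _ _ _)) //.
  apply: (@le_trans _ _ (\sum_(0 <= i < n) ln (1 + r) / k.+1%:R)).
    rewrite big_seq [leRHS]big_seq; apply: ler_sum => i.
    rewrite mem_index_iota => /andP[_ ilt]; apply: Hj; rewrite !coords_iter.
    apply: agree_sdrop; apply: agree_le xy; lia.
  rewrite sumr_const_nat subn0 -(mulr_natl _ n) mulrCA ler_piMr //.
    by rewrite ln_ge0 // lerDl ltW.
  by rewrite ler_pdivrMr // mul1r ler_nat.
exists j => _ ->; split; first by rewrite add1n; exact: H.
exact: H.
Qed.

Lemma modulus_walters : Walters lng -> modulus G setT.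
Proof.
move=> /WaltersP W k r r0.
have e0 : 0 < ln (1 + r) by rewrite ln_gt0 // ltrDl.
have [j Hj] := W _ e0; exists j => n _.
have L : expR (ln (1 + r)) <= 1 + r by rewrite lnK // posrE addr_gt0.
by split; apply: distortion_birkhoff L => x y; exact: Hj.
Qed.

Lemma distortion_bowen : Bowen lng -> exists CK, 1 <= CK /\ forall n, distortion G n 0 CK.
Proof.
move=> /BowenP[_ [K [K0 HK]]]; exists (expR K); split.
  by rewrite -expR0 ler_expR.
move=> n; apply: (@distortion_birkhoff n 0 K) => // x y xy; apply: HK.
by move: xy; rewrite addn0.
Qed.

Lemma distortion_holder : Holder lng -> exists theta D,
  [/\ 0 < theta < 1, 0 <= D & forall n j, distortion G n j (1 + D * theta ^+ j)].
Proof.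
move=> /Holder_birkhoff[C [t [/andP[t0 t1] C0 H]]].
(* For [0 <= u <= 1], [expR (C * u) - 1 <= C * u * expR (C * u) <= C * u * expR C]. *)
exists t, (C * expR C); split; first by rewrite t0.
  by rewrite mulr_ge0 // expR_ge0.
move=> n j; apply: distortion_birkhoff => [x y|]; first exact: H.
set u := t ^+ j; have u0 : 0 <= u by rewrite exprn_ge0 // ltW.
have u1 : u <= 1 by rewrite exprn_ile1 // ltW.
have h : 1 - C * u <= expR (- (C * u)).
  by have := expR_ge1Dx (- (C * u)).
have Cu0 : 0 <= C * u by rewrite mulr_ge0.
have h2 : expR (C * u) - 1 <= C * u * expR (C * u).
  have E : expR (C * u) * expR (- (C * u)) = 1 by rewrite expRN divff // gt_eqF // expR_gt0.
  have := ler_wpM2l (expR_ge0 (C * u)) h; rewrite E; lra.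
have h3 : expR (C * u) <= expR C by rewrite ler_expR ler_piMr.
have := ler_wpM2l Cu0 h3; lra.
Qed.

End Distortion.

(** * From mixing of words to mixing of points *)

Section Splice.
Context {S S' : finType} (p : S -> S') (A : rel S) (neA : sft_set A !=set0).
Local Notation X := (sft neA).

(** The word supplied for the prefixes of [x] and [x'] starts like [x] and ends in the letter of
    [x'] at [N], so [x'] can be continued from there. *)
Lemma sft_splice N : (forall (b : N.+1.-tuple S') (u w : N.+1.-tuple S),
    admissible (factor_space p X) b -> admissible X u -> admissible X w ->
    map_tuple p u = b -> map_tuple p w = b ->
    exists a : N.+1.-tuple S,
      [/\ admissible X a, map_tuple p a = b,
          tnth a ord0 = tnth u ord0 & tnth a ord_max = tnth w ord_max]) ->
  forall x x', sft_set A x -> sft_set A x' -> agree N.+1 (p \o x) (p \o x') ->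
  exists z, [/\ sft_set A z, z 0%N = x 0%N, agree N.+1 (p \o z) (p \o x') &
                sdrop N.+1 z = sdrop N.+1 x'].
Proof.
move=> H x x' Xx Xx' xx'.
have st (T : Type) (y : nat -> T) : size (stake N.+1 y) == N.+1 by rewrite size_stake.
have nst (T : Type) (y : nat -> T) (i : 'I_N.+1) : tnth (Tuple (st T y)) i = y i.
  by rewrite (tnth_nth (y 0%N)) /= nth_mkseq.
have adm (B : finType) (W : shift_space B) (y : W) : admissible W (Tuple (st B (coords y))).
  by exists y, 0%N; rewrite [in RHS]size_tuple.
have mp (y : nat -> S) : map_tuple p (Tuple (st S y)) = Tuple (st S' (p \o y)).
  by apply: val_inj; rewrite /= stake_comp.
pose X1 := @mkpt _ X x Xx; pose X2 := @mkpt _ X x' Xx'.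
have [|a [[c [k ac]] pa a0 aN]] := H (Tuple (st S' (p \o x))) (Tuple (st S x))
  (Tuple (st S x')) (adm _ _ (factor_map p X1)) (adm _ _ X1) (adm _ _ X2) (mp x).
  by rewrite mp; apply: val_inj; rewrite /= (eq_stake xx').
pose s := sdrop k (coords c).
have Xs : sft_set A s.
  by move=> i; rewrite /s /sdrop addnS; exact: (coords_in c).
have aE (i : 'I_N.+1) : tnth a i = s i.
  by rewrite (tnth_nth (s 0%N)) ac nth_mkseq // size_tuple.
have s0 : s 0%N = x 0%N by rewrite -(aE ord0) a0 nst.
have sN : s N = x' N by rewrite -(aE ord_max) aN nst.
have ps : agree N.+1 (p \o s) (p \o x').
  move=> i iN; have := congr1 (fun t => tnth t (Ordinal iN)) pa.
  by rewrite /= tnth_map aE nst /= => ->; exact: xx'.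
(* The pieces are glued at index [N], where [s] and [x'] coincide. *)
pose z := wcat (stake N s) (sdrop N x').
have zs : agree N.+1 s z.
  rewrite -[s in agree _ s](wcat_stake N) -addn1 -{1}(size_stake N s).
  by apply: agree_wcat => -[|//] _; rewrite /sdrop !addn0.
have zd : sdrop N z = sdrop N x' by rewrite -{1}(size_stake N s) sdrop_wcat.
exists z; split.
- move=> i; have [iN|Ni] := ltnP i N.
    by rewrite -(zs i) ?ltnS ?(ltnW iN) // -(zs i.+1) ?ltnS //; exact: Xs.
  have E j : z (N + j)%N = x' (N + j)%N by exact: (congr1 (fun t => t j) zd).
  by rewrite -(subnKC Ni) -addnS !E addnS; exact: Xx'.
- by rewrite -zs.
- by move=> i iN; rewrite /= -zs //; exact: ps.
- by rewrite -addn1 -!sdropD zd.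
Qed.

End Splice.

(** * The factor measure *)

Section Factor.
Context {R : realType} {S S' : finType} (p : S -> S') (A : rel S).
Context (neA : sft_set A !=set0).
Local Notation X := (sft neA).
Local Notation FY := (factor_space p X).
Local Notation fpi := (@factor_map S S' p X).

Lemma factor_lift (y : FY) : exists x : X, fpi x = y.
Proof.
by have [z Xz zy] := coords_in y; exists (@mkpt _ X z Xz); exact: coords_inj.
Qed.

Lemma factor_continuous (F : FY -> R) : continuous F -> continuous (F \o fpi).
Proof.
move=> /continuous_cyl cF; apply/continuous_cyl => x e e0.
have [n Hn] := cF (fpi x) e e0; exists n => y xy; apply: Hn.
by move=> i ni /=; rewrite /letterwise; congr p; exact: xy.
Qed.

Lemma factor_bounded (F : FY -> R) : continuous F -> exists B, forall y, `|F y| <= B.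
Proof.
move=> /factor_continuous/sft_bounded[B HB]; exists B => y.
by have [x <-] := factor_lift y; exact: HB.
Qed.

Context (G : gsystem R S) (GX : gdom G = sft_set A).

Lemma carrier_factorE z : carrier FY z <-> factor_dom p G z.
Proof. by rewrite /factor_dom GX. Qed.

Lemma gdom_coords (x : X) : gdom G (coords x).
Proof. by rewrite GX; exact: (coords_in x). Qed.

Context (N : nat) (mix : forall x x', gdom G x -> gdom G x' ->
  agree N.+1 (p \o x) (p \o x') ->
  exists z, [/\ gdom G z, z 0%N = x 0%N, agree N.+1 (p \o z) (p \o x') &
                sdrop N.+1 z = sdrop N.+1 x']).

Lemma factor_markov : markov FY N.+1.
Proof.
move=> b y y' _ /carrier_factorE Yy' yy' /carrier_factorE Yb.
apply/carrier_factorE; exact: (factor_dom_scons mix Yy' yy' Yb).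
Qed.

Context (CK : R) (CK_ge1 : 1 <= CK) (bowen : forall n, distortion G n 0 CK).
Context (mod1 : modulus G [set 1%N]).

Definition hfactor (y : FY) : R := hlim p G (coords y).
Local Notation h := hfactor.

Let bC := baseC G N CK.
Let bC_gt0 : 0 < bC. Proof. exact: baseC_gt0. Qed.

Lemma hfactor_ge y : bC * gmin G <= h y.
Proof. by have [x <-] := factor_lift y; exact: (hlim_ge mix _ _ (gdom_coords x)). Qed.

Lemma hfactor_gt0 y : 0 < h y.
Proof. by apply: lt_le_trans (hfactor_ge y); rewrite mulr_gt0 // gmin_gt0. Qed.

Lemma hfactor_le1 y : h y <= 1.
Proof. by have [x <-] := factor_lift y; exact: (hlim_le1 p (gdom_coords x)). Qed.

Lemma ext_hfactor z : ext h z = hlim0 p G z.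
Proof.
have [k|k] := pselect (carrier FY z).
  by rewrite (ext_mkpt _ k) hlim0_in //; apply/carrier_factorE.
by rewrite ext_out // hlim0_out // => /carrier_factorE.
Qed.

Lemma hfactor_hprod1 y : hprod p G 1 (coords y) = h y.
Proof. by rewrite /hprod big_nat1 sdrop0. Qed.

Lemma hfactor_osc (I : set nat) n k r (y y' : FY) : I n ->
  osc_bound p G N CK I k r -> 0 <= r -> agree (n + k) (coords y) (coords y') ->
  hprod p G n (coords y) <= (1 + r / bC) * hprod p G n (coords y').
Proof.
have [x <-] := factor_lift y; have [x' <-] := factor_lift y'.
have Xx := gdom_coords x; have Xx' := gdom_coords x'.
move=> In Ik r0 yy'; exact: (hprod_osc mix _ bowen mod1 In Ik).
Qed.

Lemma hfactor_continuous : continuous h.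
Proof.
apply/continuous_cyl => y e e0.
have r0 : 0 < e * bC by rewrite mulr_gt0.
have [k Hk] := osc_bound_small mix CK_ge1 bowen mod1 r0.
have H (u v : FY) : agree k.+1 (coords u) (coords v) -> h u <= h v + e.
  move=> uv; have := hfactor_osc (erefl : [set 1%N] 1%N) Hk (ltW r0) uv.
  rewrite !hfactor_hprod1 mulfK ?lt0r_neq0 // mulrDl mul1r => hu.
  by rewrite (le_trans hu) // lerD2l ler_piMr ?(ltW e0) // hfactor_le1.
exists k.+1 => y' yy'; have := H _ _ yy'; have := H _ _ (agree_sym yy').
by rewrite ler_norml; lra.
Qed.

Lemma hfactor_g_function : is_g_function h.
Proof.
split; first exact: hfactor_continuous.
  by move=> y; rewrite hfactor_gt0 hfactor_le1.
move=> y; rewrite preimage_sum.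
under eq_bigr do rewrite ext_hfactor.
apply: (hlim0_sum mix CK_ge1 bowen mod1); apply/carrier_factorE.
exact: coords_in.
Qed.

Lemma birkhoff_hfactor n y :
  birkhoff_sum n (fun y => ln (h y)) y = ln (hprod p G n (coords y)).
Proof.
rewrite (birkhoff_ln n y hfactor_gt0); congr ln.
by apply: eq_bigr => i _; rewrite /hfactor coords_iter.
Qed.

Lemma hprod_factor_gt0 n (y : FY) : 0 < hprod p G n (coords y).
Proof.
rewrite /hprod prodr_gt0 // => i _; rewrite -coords_iter; exact: hfactor_gt0.
Qed.

Lemma birkhoff_hfactor_le n C (y y' : FY) : 0 < C ->
  hprod p G n (coords y) <= C * hprod p G n (coords y') ->
  hprod p G n (coords y') <= C * hprod p G n (coords y) ->
  `|birkhoff_sum n (fun y => ln (h y)) y -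
    birkhoff_sum n (fun y => ln (h y)) y'| <= ln C.
Proof.
move=> C0 h1 h2; rewrite !birkhoff_hfactor.
have L (a b : R) : 0 < a -> 0 < b -> a <= C * b -> ln a <= ln C + ln b.
  by move=> a0 b0 ab; rewrite -lnM ?posrE // ler_ln ?posrE // mulr_gt0.
have l1 := L _ _ (hprod_factor_gt0 n y) (hprod_factor_gt0 n y') h1.
have l2 := L _ _ (hprod_factor_gt0 n y') (hprod_factor_gt0 n y) h2.
by rewrite ler_norml; lra.
Qed.

Lemma ln_hfactor_continuous : continuous (fun y => ln (h y)).
Proof.
by move=> y; apply: (@continuous_comp _ _ _ h (@ln R));
  [exact: hfactor_continuous|apply: continuous_ln; exact: hfactor_gt0].
Qed.

Lemma hfactor_bowen : Bowen (fun y => ln (h y)).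
Proof.
apply/BowenP; split; first exact: ln_hfactor_continuous.
pose C := harnackC G N CK ^+ 2 / bC.
have C0 : 0 < C by rewrite divr_gt0 // exprn_gt0 // harnackC_gt0.
have H n (y y' : FY) : agree n (coords y) (coords y') ->
    hprod p G n (coords y) <= C * hprod p G n (coords y').
  have [x <-] := factor_lift y; have [x' <-] := factor_lift y'.
have Xx := gdom_coords x; have Xx' := gdom_coords x'.
  by move=> yy'; exact: (hprod_bowen mix _ bowen mod1).
exists `|ln C|; split => // n y y' yy'.
apply: le_trans (ler_norm _); apply: birkhoff_hfactor_le => //; apply: H => //.
exact: agree_sym.
Qed.

Lemma hfactor_walters : modulus G setT -> Walters (fun y => ln (h y)).
Proof.
move=> modT; apply/WaltersP => e e0.
(* With this [r], [ln (1 + r / bC)] is exactly [e]. *)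
have r0 : 0 < (expR e - 1) * bC by rewrite mulr_gt0 // subr_gt0 expR_gt1.
have [k Hk] := osc_bound_small mix CK_ge1 bowen modT r0; exists k => n y y' yy'.
have -> : e = ln (1 + (expR e - 1) * bC / bC).
  by rewrite mulfK ?lt0r_neq0 // addrC subrK expRK.
have h1 := hfactor_osc (n := n) Logic.I Hk (ltW r0) yy'.
have h2 := hfactor_osc (n := n) Logic.I Hk (ltW r0) (agree_sym yy').
apply: birkhoff_hfactor_le => //.
by rewrite mulfK ?lt0r_neq0 // addrC subrK expR_gt0.
Qed.

Lemma hfactor_holder theta D : 0 < theta < 1 -> 0 <= D ->
  (forall n j, distortion G n j (1 + D * theta ^+ j)) -> Holder (fun y => ln (h y)).
Proof.
move=> t01 D0 hold.
have [K [t [K0 /andP[t0 t1] HK]]] := osc_bound_exp mix CK_ge1 bowen t01 D0 hold.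
have bow := hfactor_bowen; move/BowenP : bow => [_ [B [B0 HB]]].
have tX i : 0 < t ^+ i by rewrite exprn_gt0.
pose C0 := B + `|ln (bC * gmin G)|.
(* One letter for the numerator and [N.+1] before the geometric decay sets in; below this level the
   bound on [ln h] suffices, at the cost of dividing by [t ^+ M]. *)
pose M := (1 + N.+1)%N.
have lnh y : `|ln (h y)| <= `|ln (bC * gmin G)|.
  have kg : 0 < bC * gmin G by rewrite mulr_gt0 // gmin_gt0.
  have l0 : ln (h y) <= 0 by rewrite ln_le0 // hfactor_le1.
  have l1 : ln (bC * gmin G) <= ln (h y).
    by rewrite ler_ln ?posrE ?hfactor_gt0 // hfactor_ge.
  by rewrite !ler0_norm // ?lerN2 // (le_trans l1).
exists ((2 * `|ln (bC * gmin G)| + K / bC) / t ^+ M), t; split; first by rewrite t0.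
move=> n; apply/var_leP => y y' yy'.
have K1 : 0 <= K / bC by rewrite divr_ge0 // ltW.
rewrite mulrAC; have [nM|Mn] := ltnP n M.
  rewrite ler_pdivlMr //.
  apply: (@le_trans _ _ ((2 * `|ln (bC * gmin G)|) * t ^+ n)); last first.
    by rewrite ler_wpM2r ?(ltW (tX _)) // lerDl.
  apply: ler_pM; rewrite ?(ltW (tX _)) //.
    by apply: (le_trans (ler_normB _ _)); have := lnh y; have := lnh y'; lra.
  by apply: ler_wiXn2l; rewrite ?(ltW t0) ?(ltW t1) // ltnW.
pose k := (n - M)%N.
have nE : n = (1 + (N.+1 + k))%N by rewrite addnA -/M /k subnKC.
have tk : t ^+ n / t ^+ M = t ^+ k.
  by rewrite nE addnA exprD -/M mulrC mulKf // lt0r_neq0.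
rewrite -mulrA tk.
have r0 : 0 <= K * t ^+ k by rewrite mulr_ge0 // ltW.
rewrite nE in yy'.
have h1 := hfactor_osc (Logic.I : setT 1%N) (HK setT k) r0 yy'.
have h2 := hfactor_osc (Logic.I : setT 1%N) (HK setT k) r0 (agree_sym yy').
have q0 : 0 <= K * t ^+ k / bC by rewrite divr_ge0 // ltW.
have := @birkhoff_hfactor_le 1 (1 + K * t ^+ k / bC) y y' _ h1 h2.
rewrite !birkhoff1 => H; apply: le_trans (H _) _; first by rewrite ltr_wpDr.
have := @le_ln1Dx R (K * t ^+ k / bC); rewrite (lt_le_trans _ q0) // => /(_ isT) H1.
apply: (le_trans H1); rewrite mulrAC ler_wpM2r ?(ltW (tX _)) // lerDr.
by rewrite mulr_ge0.
Qed.

End Factor.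

Lemma sube0_eq {R : realType} (a b : \bar R) : a \is a fin_num ->
  (0 = a - b)%E -> b = a.
Proof.
case: a b => [r| |] [s| |] //= _ [] /esym/eqP.
by rewrite subr_eq0 => /eqP ->.
Qed.

(** * The g-measure identity and uniqueness of the g-function *)

Section FactorMeasure.
Context {R : realType} {S S' : finType} (p : S -> S') (A : rel S).
Context (neA : sft_set A !=set0).
Local Notation X := (sft neA).
Local Notation FY := (factor_space p X).
Local Notation fpi := (@factor_map S S' p X).
Context (g : X -> R) (mu : probability X R) (gmu : is_g_measure_for mu g).
Local Notation nu := (distribution mu fpi).

Let gfn : is_g_function g. Proof. by case: gmu. Qed.

Lemma integral_factor (F : FY -> R) : continuous F ->
  (\int[nu]_y (F y)%:E = \int[mu]_x (F (fpi x))%:E)%E.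
Proof.
move=> cF; have [B HB] := factor_bounded cF.
rewrite integral_distribution //.
  by apply/measurable_EFinP; exact: continuous_measurable.
apply: (@continuous_integrable _ _ _ mu (F \o fpi) B) => [|x]; last exact: HB.
exact: factor_continuous.
Qed.

Lemma factor_integrable (F : FY -> R) : continuous F ->
  nu.-integrable [set: FY] (EFin \o F).
Proof.
move=> cF; have [B HB] := factor_bounded cF.
exact: continuous_integrable HB.
Qed.

Context (G : gsystem R S) (GX : gdom G = sft_set A) (Gg : gfun G = ext g).
Context (N : nat) (mix : forall x x', gdom G x -> gdom G x' ->
  agree N.+1 (p \o x) (p \o x') ->
  exists z, [/\ gdom G z, z 0%N = x 0%N, agree N.+1 (p \o z) (p \o x') &
                sdrop N.+1 z = sdrop N.+1 x']).
Context (CK : R) (CK_ge1 : 1 <= CK) (bowen : forall n, distortion G n 0 CK).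
Context (mod1 : modulus G [set 1%N]).
Local Notation h := (@hfactor R S S' p A neA G).

(** The preimages of [x] are grouped by the image of their first letter. *)
Lemma defect_ltransfer (f : FY -> R) (x : X) :
  defect p G (ext f) (coords x) = ltransfer g (f \o fpi) x -
  \sum_(y \in [set y | shift y = fpi x]) (h y * f y).
Proof.
rewrite /ltransfer !preimage_sum (partition_big p xpredT) //= -sumrB.
apply: eq_bigr => b _; rewrite mulrBr; congr (_ - _).
  rewrite /fiber_sum fiber_op1 mulr_sumr; apply: eq_bigr => a /eqP pa.
  rewrite mulr1 Gg; have [k|k] := pselect (carrier X (scons a (coords x))).
    rewrite !(ext_mkpt _ k) mulrC; congr (_ * _).
    by rewrite -(ext_coords f) -pa -scons_comp.
  by rewrite !(ext_out _ k) mulr0.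
rewrite mulrC; have [k|k] := pselect (carrier FY (scons b (coords (fpi x)))).
  by rewrite !(ext_mkpt _ k) -(ext_hfactor p neA GX) (ext_mkpt _ k).
by rewrite -(ext_hfactor p neA GX) !ext_out // mul0r.
Qed.

Lemma hfactor_g_measure : is_g_measure_for nu h.
Proof.
have hg := hfactor_g_function neA GX mix CK_ge1 bowen mod1.
split; first exact: hg.
move=> f cf; have [ch _ _] := hg.
pose F y := \sum_(y' \in [set y' : FY | shift y' = y]) (h y' * f y').
have cF : continuous F.
  apply: (@preimage_sum_continuous _ _ FY N.+1 (fun y => h y * f y)
    (factor_markov GX mix)) => y.
  exact: (cvgM (ch y) (cf y)).
have cfp := factor_continuous cf; have cFp := factor_continuous cF.
rewrite [LHS](integral_factor cF) (integral_factor cf).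
have cL := ltransfer_continuous gfn cfp.
pose v (x : X) := ltransfer g (f \o fpi) x - F (fpi x).
have cv : continuous v.
  by move=> x; exact: (cvgB (cL x) (cFp x)).
have [B HB] := factor_bounded cf.
have vsmall r : 0 < r -> (`|\int[mu]_x (v x)%:E| <= r%:E)%E.
  move=> r0.
  have fB (y : nat -> S') : `|ext f y| <= B.
    have [k|k] := pselect (carrier FY y); first by rewrite (ext_mkpt _ k) HB.
    rewrite ext_out // normr0; exact: le_trans (normr_ge0 _) (HB point).
  have [n Hn] := defect_small mix CK_ge1 bowen mod1 fB r0.
  (* The integral of [v] equals that of its [n]-th transfer, which is uniformly small although [v]
     need not be. *)
  have [<- cn] := integral_iter_ltransfer gfn gmu n cv.
  apply: integral_small => //; first exact: ltW.
  move=> x; have Xx : gdom G (coords x) by rewrite GX; exact: (coords_in x).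
  rewrite (iter_ltransfer Gg).
  rewrite (@iter_transfer_eq _ _ G n _ (defect p G (ext f))) //; first exact: Hn.
  move=> y; rewrite GX => Xy; rewrite (@ext_mkpt _ _ X v y Xy) /v.
  by rewrite -[in RHS](@coords_mkpt _ X y Xy) defect_ltransfer.
have v0 : (\int[mu]_x (v x)%:E = 0)%E.
  apply/eqP; rewrite -abse_eq0 eq_le abse_ge0 andbT.
  by apply/lee_addgt0Pr => e e0; rewrite add0e; exact: vsmall.
have [B1 HB1] := sft_bounded cL; have [B2 HB2] := factor_bounded cF.
have iFp := @continuous_integrable _ _ _ mu (f \o fpi) B cfp (fun x => HB (fpi x)).
have iL := continuous_integrable mu cL HB1.
have iF := @continuous_integrable _ _ _ mu (F \o fpi) B2 cFp (fun x => HB2 (fpi x)).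
have IB := integralB_EFin measurableT iL iF.
have EL : (\int[mu]_x (ltransfer g (f \o fpi) x)%:E =
    \int[mu]_x (f (fpi x))%:E)%E by exact: gmu.2 _ cfp.
have Ev : (\int[mu]_x ((ltransfer g (f \o fpi) x)%:E - (F (fpi x))%:E) =
    \int[mu]_x (v x)%:E)%E by apply: eq_integral => x _; rewrite EFinB.
rewrite -EL; apply: sube0_eq; last by rewrite -[LHS]v0 -Ev; exact: IB.
exact: (integrable_fin_num measurableT iL).
Qed.

(** With [D = h1 - h2], both identities are tested on [h2 * D]. Subtracting, the transfer of [D * D]
    by [h2] has integral 0, hence so has [D * D]; positivity of integrals on the subshift then gives
    [D = 0]. *)
Lemma g_function_unique (h1 h2 : FY -> R) : topologically_mixing X ->
  is_g_measure_for nu h1 -> is_g_measure_for nu h2 -> h1 = h2.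
Proof.
move=> mixA [[c1 _ _] E1] [[c2 _ _] E2].
pose D y := h1 y - h2 y.
have cD : continuous D by move=> y; exact: (cvgB (c1 y) (c2 y)).
have cDD : continuous (fun y => D y * D y).
  by move=> y; exact: (cvgM (cD y) (cD y)).
have cf : continuous (fun y => h2 y * D y).
  by move=> y; exact: (cvgM (c2 y) (cD y)).
pose F (k : FY -> R) y := \sum_(y' \in [set y' : FY | shift y' = y]) (k y' * (h2 y' * D y')).
have cF k : continuous k -> continuous (F k).
  move=> ck; apply: (@preimage_sum_continuous _ _ FY N.+1
    (fun y => k y * (h2 y * D y)) (factor_markov GX mix)) => y.
  exact: (cvgM (ck y) (cf y)).
have I0 : (\int[nu]_y (D y * D y)%:E = 0)%E.
  rewrite -(E2 _ cDD).
  transitivity (\int[nu]_y ((F h1 y)%:E - (F h2 y)%:E))%E.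
    apply: eq_integral => y _; rewrite -EFinB; congr EFin.
    rewrite /F !preimage_sum -sumrB; apply: eq_bigr => a _.
    have [k|k] := pselect (carrier FY (scons a (coords y))).
      by rewrite !(ext_mkpt _ k) /D; ring.
    by rewrite !ext_out // subr0.
  rewrite integralB_EFin //; [|exact: factor_integrable (cF _ c1)
    |exact: factor_integrable (cF _ c2)].
  rewrite (E1 _ cf) (E2 _ cf) subee //.
  exact: (integrable_fin_num measurableT (factor_integrable cf)).
apply/funext => y; apply/eqP; rewrite -subr_eq0 -/(D y); apply: contrapT => Dy.
have [x xy] := factor_lift y.
have DD0 : 0 < D y * D y by rewrite -expr2 exprn_even_gt0 //; apply/orP; right; exact/negP.
have P0 x' : 0 <= D (fpi x') * D (fpi x') by rewrite -expr2 sqr_ge0.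
have Px : 0 < D (fpi x) * D (fpi x) by rewrite xy.
have := integral_gt0 gfn GX Gg gmu mixA (factor_continuous cDD) P0 Px.
by rewrite -(integral_factor cDD) I0 ltxx.
Qed.

End FactorMeasure.

Theorem corollary1p4 (R : realType) (S S' : finType)
    (A : rel S) (neA : sft_set A !=set0) (p : S -> S')
    (g : sft neA -> R) (mu : probability (sft neA) R)
    (mixA : topologically_mixing (sft neA))
    (gmu : is_g_measure_for mu g)
    (mixpi : fiberwise_subpositive_mixing p (sft neA)) :
  let nu : probability (factor_space p (sft neA)) R :=
    distribution mu (@factor_map S S' p (sft neA)) in
  [/\ Bowen (fun x => ln (g x)) ->
        is_g_measure nu /\
        (forall h, is_g_measure_for nu h -> Bowen (fun y => ln (h y))),
      Walters (fun x => ln (g x)) ->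
        is_g_measure nu /\
        (forall h, is_g_measure_for nu h -> Walters (fun y => ln (h y))) &
      Holder (fun x => ln (g x)) ->
        is_g_measure nu /\
        (forall h, is_g_measure_for nu h -> Holder (fun y => ln (h y)))].
Proof.
move=> nu; have gfn : is_g_function g by case: gmu.
have [G [GX Gg]] := sft_gsystem gfn.
have [N HN] := mixpi.
have mix x x' : gdom G x -> gdom G x' -> agree N.+1 (p \o x) (p \o x') ->
    exists z, [/\ gdom G z, z 0%N = x 0%N, agree N.+1 (p \o z) (p \o x') &
                  sdrop N.+1 z = sdrop N.+1 x'].
  by rewrite GX; exact: sft_splice.
have mod1 := modulus1 gfn GX Gg.
have cln := ln_g_continuous gfn.
have WB : Walters (fun x => ln (g x)) -> Bowen (fun x => ln (g x)).
  exact: Walters_Bowen cln (sft_bounded cln).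
have HW : Holder (fun x => ln (g x)) -> Walters (fun x => ln (g x)).
  exact: Holder_Walters.
(* Each class implies Bowen, which produces [hfactor]; uniqueness then carries [Q] from it to an
   arbitrary g-function of [nu]. *)
have main (Q : (factor_space p (sft neA) -> R) -> Prop) :
    Bowen (fun x => ln (g x)) ->
    (forall CK, 1 <= CK -> (forall n, distortion G n 0 CK) ->
       Q (fun y => ln (@hfactor R S S' p A neA G y))) ->
    is_g_measure nu /\
    (forall h, is_g_measure_for nu h -> Q (fun y => ln (h y))).
  move=> /(distortion_bowen gfn GX Gg)[CK [CK1 HCK]] HQ.
  have hg := hfactor_g_measure gmu GX Gg mix CK1 HCK mod1.
  split; first by eexists; exact: hg.
  move=> h /(g_function_unique gmu GX Gg mix mixA) /(_ hg) ->.
  exact: HQ HCK.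
split=> H.
- apply: (main (@Bowen R S' _)) => // CK CK1 HCK.
  exact: (hfactor_bowen neA GX mix CK1 HCK mod1).
- apply: (main (@Walters R S' _)) => [|CK CK1 HCK]; first exact: WB.
  apply: (hfactor_walters neA GX mix CK1 HCK mod1).
  exact: modulus_walters H.
- apply: (main (@Holder R S' _)) => [|CK CK1 HCK]; first exact/WB/HW.
  have [t [D [t01 D0 hold]]] := distortion_holder gfn GX Gg H.
  exact: (hfactor_holder neA GX mix CK1 HCK mod1 t01 D0 hold).
Qed.
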